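(* Let $G,H$ be finitely presented and computably quasi-isometric groups with decidable word problem. Then $\mathfrak{M}_{\mathtt{SFT}}(G)=\mathfrak{M}_{\mathtt{SFT}}(H)$.
   Context: Finitely generated groups carry word metrics. Let $G,H$ be generated by finite symmetric sets $S,T$. A map $f\colon H\to G$ is computable if there is a computable map $\widehat f\colon T^*\to S^*$ such that whenever $u$ represents $h\in H$, $\widehat f(u)$ represents $f(h)$. $f$ is a quasi-isometry if there is $C\ge1$ with $\frac1Cd_H(h,h')-C\le d_G(f(h),f(h'))\le Cd_H(h,h')+C$ for all $h,h'$ and every point of $G$ is within distance $C$ of $f(H)$. Two finitely generated groups are computably quasi-isometric if there is a computable quasi-isometry between them. A finitely generated group has decidable word problem if the set of words in a finite generating set representing the identity is decidable. Alphabets are finite. For a group $G$ and alphabet $A$, $A^G=\{x\colon G\to A\}$ carries the prodiscrete topology and the shift action $(gx)(h)=x(g^{-1}h)$. A $G$-subshift is a closed $G$-invariant set $X\subset A^G$. For finite $F\subset G$ and a pattern $p\in A^F$ let $[p]=\{x\in A^G: x|_F=p\}$. $X$ is a subshift of finite type (SFT) if there is a finite set $\mathcal F$ of patterns with $X=\{x: gx\notin[p]\ \forall g\in G,\ p\in\mathcal F\}$. Medvedev degrees: for $P,Q\subset\{0,1\}^{\mathbb N}$ write $P\le Q$ if there is a partial computable function $\Psi$ on $\{0,1\}^{\mathbb N}$ (a Turing functional) defined on all of $Q$ with $\Psi(Q)\subset P$. The Medvedev degree $m(P)$ is the class of $P$ under the equivalence $P\le Q\le P$. For a group $G$ with finite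 generating set $S$, free group $F(S)$ and canonical epimorphism $\rho\colon F(S)\to G$, the pullback of a subshift $X\subset A^G$ is $\widehat X=\{x\circ\rho: x\in X\}\subset A^{F(S)}$. Via a computable bijection $\mathbb N\to F(S)$ and a fixed-length binary coding of $A$, $\widehat X$ is identified with a subset of $\{0,1\}^{\mathbb N}$, and $m(X):=m(\widehat X)$ (independent of choices). $\mathfrak{M}_{\mathtt{SFT}}(G)=\{m(X): X\text{ a nonempty }G\text{-SFT}\}$. *)

(* Defs.v *)
From HB Require Import structures.
From Stdlib Require Cantor.
From mathcomp Require Import all_boot ssralg ssrnum finmap.
From mathcomp Require Import boolp classical_sets Rstruct.

Set Implicit Arguments.
Unset Strict Implicit.
Unset Printing Implicit Defensive.

Local Open Scope classical_set_scope.

(* Computability: Kleene's partial recursive functions relative to an        *)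
(* oracle, presented as unary functions on nat via the Cantor pairing.       *)

Definition npair (x y : nat) : nat := Cantor.to_nat (x, y).

Inductive prog : Type :=
| Zero
| Succ
| Fst
| Snd
| Oracle
| Pair of prog & prog
| Comp of prog & prog
| PrimRec of prog & prog
| Mu of prog.

(* [eval o p x y]: with oracle o, the program p halts on input x with        *)
(* output y.                                                                 *)
Fixpoint eval (o : nat -> bool) (p : prog) : nat -> nat -> Prop :=
  match p with
  | Zero => fun _ y => y = 0
  | Succ => fun x y => y = x.+1
  | Fst => fun x y => y = (Cantor.of_nat x).1
  | Snd => fun x y => y = (Cantor.of_nat x).2
  | Oracle => fun x y => y = o x
  | Pair f g => fun x y =>
      exists u v, [/\ eval o f x u, eval o g x v & y = npair u v]
  | Comp f g => fun x y => exists2 z, eval o g x z & eval o f z y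
  | PrimRec f g => fun x y =>
      let: (a, n) := Cantor.of_nat x in
      (fix loop (m r : nat) : Prop :=
         match m with
         | 0 => eval o f a r
         | k.+1 => exists2 r', loop k r' & eval o g (npair a (npair k r')) r
         end) n y
  | Mu f => fun x y =>
      eval o f (npair x y) 0 /\
      forall k, k < y -> exists v, eval o f (npair x k) v.+1
  end.

(* Computability without oracle is computability from the zero oracle.       *)
Definition computes (p : prog) (x y : nat) : Prop :=
  eval (fun=> false) p x y.

Definition seq_code (s : seq nat) : nat :=
  foldr (fun a c => (npair a c).+1) 0 s.

Definition word_code (n : nat) (w : seq 'I_n) : nat :=
  seq_code [seq val i | i <- w].

Definition cantor_space : Type := nat -> bool.

(* Graph of the partial map on Cantor space computed by p: its domain        *)
(* consists of the x for which p with oracle x is total and 0/1-valued.      *)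
Definition turing_functional (p : prog) (x y : cantor_space) : Prop :=
  forall n, eval x p n (y n).

Definition medvedev_le (P Q : set cantor_space) : Prop :=
  exists p, forall x, Q x -> exists2 y, P y & turing_functional p x y.

Definition medvedev_equiv (P Q : set cantor_space) : Prop :=
  medvedev_le P Q /\ medvedev_le Q P.

Definition medvedev_degree (P : set cantor_space) : set (set cantor_space) :=
  [set Q | medvedev_equiv P Q].

(* The free group on n generators: reduced words, multiplied by              *)
(* concatenation followed by free reduction.                                 *)

(* (i, false) is the i-th generator and (i, true) its inverse.               *)
Notation letter n := ('I_n * bool)%type.

Section FreeGroup.
Variable n : nat.
Implicit Types (a b : letter n) (u v w : seq (letter n)).

Definition inv_letter a : letter n := (a.1, ~~ a.2).

Definition reduced w : bool := sorted (fun a b => b != inv_letter a) w.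

Definition cons_red a w : seq (letter n) :=
  if w is b :: w' then if b == inv_letter a then w' else a :: w else [:: a].

Definition mul_red u v : seq (letter n) := foldr cons_red v u.

Definition inv_word w : seq (letter n) := rev (map inv_letter w).

Record free_group : Type :=
  FreeGroup { fg_word :> seq (letter n); fg_reduced : reduced fg_word }.

HB.instance Definition _ := [isSub for fg_word].
HB.instance Definition _ := [Choice of free_group by <:].

Lemma inv_letterK : involutive inv_letter.
Proof. by case=> i b; rewrite /inv_letter /= negbK. Qed.

Lemma reduced_cons_red a w : reduced w -> reduced (cons_red a w).
Proof.
case: w => [|b w] //= red_w; case: eqP => [_|/eqP ba]; first exact: path_sorted red_w.
by rewrite /reduced /= ba.
Qed.

Lemma reduced_mul u v : reduced v -> reduced (mul_red u v).
Proof. by move=> red_v; elim: u => //= a u; apply: reduced_cons_red. Qed.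

Lemma cons_redK a w :
  reduced w -> cons_red (inv_letter a) (cons_red a w) = w.
Proof.
case: w => [|b w] /=; first by rewrite inv_letterK eqxx.
case: eqP => [->|/eqP ba] /=; last by rewrite inv_letterK eqxx.
by case: w => [|c w] //=; rewrite inv_letterK => /andP[/negPf->].
Qed.

Lemma mul_red_cons a u v :
  reduced u -> reduced v -> mul_red (cons_red a u) v = cons_red a (mul_red u v).
Proof.
case: u => [|b u] //= red_u red_v; case: eqP => [->|//].
by have := @cons_redK (inv_letter a) (mul_red u v) (reduced_mul u red_v);
  rewrite inv_letterK.
Qed.

Lemma mul_redA u v w : reduced v -> reduced w ->
  mul_red u (mul_red v w) = mul_red (mul_red u v) w.
Proof.
move=> red_v red_w; elim: u => //= a u ->.
by rewrite mul_red_cons // reduced_mul.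
Qed.

Lemma mul_red0 w : reduced w -> mul_red w [::] = w.
Proof.
elim: w => //= a w IHw red_aw.
rewrite IHw; last exact: path_sorted red_aw.
by case: w red_aw {IHw} => //= b w /andP[/negPf->].
Qed.

Lemma reduced_inv w : reduced w -> reduced (inv_word w).
Proof.
rewrite /reduced /inv_word rev_sorted sorted_map; apply: sub_sorted => a b /=.
by rewrite inv_letterK eq_sym.
Qed.

Lemma mul_red_cat u v w : mul_red (u ++ v) w = mul_red u (mul_red v w).
Proof. by rewrite /mul_red foldr_cat. Qed.

Lemma mul_redV w v : reduced v -> mul_red (inv_word w) (mul_red w v) = v.
Proof.
elim: w v => //= a w IHw v red_v.
by rewrite /inv_word /= rev_cons -cats1 mul_red_cat /= cons_redK ?IHw // reduced_mul.
Qed.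

Lemma inv_wordK : involutive inv_word.
Proof. by move=> w; rewrite /inv_word map_rev revK (mapK inv_letterK). Qed.

Definition fg_one : free_group := FreeGroup (isT : reduced [::]).
Definition fg_mul (x y : free_group) : free_group :=
  FreeGroup (reduced_mul x (fg_reduced y)).
Definition fg_inv (x : free_group) : free_group :=
  FreeGroup (reduced_inv (fg_reduced x)).

Lemma fg_mulA : associative fg_mul.
Proof. by move=> x y z; apply/val_inj/mul_redA; apply: fg_reduced. Qed.

Lemma fg_mul1 : left_id fg_one fg_mul.
Proof. by move=> x; apply/val_inj. Qed.

Lemma fg_mulr1 : right_id fg_one fg_mul.
Proof. by move=> x; apply/val_inj/mul_red0/fg_reduced. Qed.

Lemma fg_mulV : left_inverse fg_one fg_inv fg_mul.
Proof.
move=> x; apply/val_inj => /=.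
by rewrite -[X in mul_red _ X]mul_red0 ?mul_redV //; apply: fg_reduced.
Qed.

Lemma fg_mulrV : right_inverse fg_one fg_inv fg_mul.
Proof.
move=> x; rewrite -{1}[x](_ : fg_inv (fg_inv x) = x) ?fg_mulV //.
by apply/val_inj/inv_wordK.
Qed.

HB.instance Definition _ := isGroup.Build free_group
  fg_mulA fg_mul1 fg_mulr1 fg_mulV fg_mulrV.

Definition fg_code (x : free_group) : nat :=
  seq_code [seq (val l.1).*2 + l.2 | l : letter n <- fg_word x].

End FreeGroup.

Section Groups.
Local Open Scope group_scope.

Definition fg_eval (G : groupType) (n : nat) (s : 'I_n -> G)
    (w : free_group n) : G :=
  \prod_(l <- fg_word w) (if l.2 then (s l.1)^-1 else s l.1).

Definition normal_subgroup (K : groupType) (N : set K) : Prop :=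
  [/\ N 1, forall x y, N x -> N y -> N (x * y), forall x, N x -> N x^-1
    & forall x y, N x -> N (x ^ y)].

Definition normal_closure (K : groupType) (R : set K) : set K :=
  [set x | forall N, normal_subgroup N -> R `<=` N -> N x].

Definition finitely_presented (G : groupType) : Prop :=
  exists (n : nat) (s : 'I_n -> G) (R : seq (free_group n)),
    (forall g, exists w, fg_eval s w = g) /\
    [set w | fg_eval s w = 1] = normal_closure [set` R].

(* Finite generating sets are enumerated without repetition by some 'I_n.    *)
Definition generating (G : groupType) (n : nat) (s : 'I_n -> G) : Prop :=
  injective s /\ forall g, exists w, fg_eval s w = g.

Definition word_eval (G : groupType) (n : nat) (s : 'I_n -> G)
    (w : seq 'I_n) : G := \prod_(i <- w) s i.

Definition symmetric_generating (G : groupType) (n : nat) (s : 'I_n -> G) :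
    Prop :=
  [/\ injective s, forall i, exists j, s j = (s i)^-1
    & forall g, exists w, word_eval s w = g].

Definition word_length (G : groupType) (n : nat) (s : 'I_n -> G) (g : G) :
    nat :=
  xget 0%N [set k | (exists2 w, word_eval s w = g & size w = k) /\
                    (forall w, word_eval s w = g -> (k <= size w)%N)].

Definition word_dist (G : groupType) (n : nat) (s : 'I_n -> G) (g h : G) :
    nat := word_length s (g^-1 * h).

Definition decidable_word_problem (G : groupType) : Prop :=
  exists (n : nat) (s : 'I_n -> G), symmetric_generating s /\
    exists p, forall w, computes p (word_code w) `[< word_eval s w = 1 >].

Definition computable_map (H G : groupType) (m n : nat) (t : 'I_m -> H)
    (s : 'I_n -> G) (f : H -> G) : Prop :=
  exists F : seq 'I_m -> seq 'I_n,
    (exists p, forall u, computes p (word_code u) (word_code (F u))) /\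
    forall u, word_eval s (F u) = f (word_eval t u).

End Groups.

Definition quasi_isometry (H G : groupType) (m n : nat) (t : 'I_m -> H)
    (s : 'I_n -> G) (f : H -> G) : Prop :=
  exists C : Rdefinitions.R,
    [/\ (1 <= C)%R,
        forall h h',
          (C^-1 * (word_dist t h h')%:R - C <= (word_dist s (f h) (f h'))%:R
            <= C * (word_dist t h h')%:R + C)%R
      & forall g, exists h, ((word_dist s g (f h))%:R <= C)%R].

Definition computably_quasi_isometric (H G : groupType) : Prop :=
  exists (m : nat) (t : 'I_m -> H) (n : nat) (s : 'I_n -> G) (f : H -> G),
    [/\ symmetric_generating t, symmetric_generating s,
        computable_map t s f & quasi_isometry t s f].

Definition shift (G : groupType) (A : Type) (g : G) (x : G -> A) : G -> A :=
  fun h => x (g^-1 * h)%g.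

(* A pattern is a finitely supported partial map from G to A.                *)
Definition cylinder (G : groupType) (A : finType) (p : {fmap G -> A}) :
    set (G -> A) :=
  [set x | forall h : domf p, x (val h) = p h].

(* Sets of this form are automatically closed and shift-invariant.           *)
Definition SFT (G : groupType) (A : finType) (X : set (G -> A)) : Prop :=
  exists F : {fset {fmap G -> A}},
    X = [set x | forall g p, p \in F -> ~ cylinder p (shift g x)].

Definition pullback (G : groupType) (A : Type) (n : nat) (s : 'I_n -> G)
    (X : set (G -> A)) : set (free_group n -> A) :=
  [set x \o fg_eval s | x in X].

Definition computable_bijection (n : nat) (nu : nat -> free_group n) : Prop :=
  bijective nu /\ exists p, forall k, computes p k (fg_code (nu k)).

(* Concatenation of the blocks c (y (nu 0)), c (y (nu 1)), ...               *)
Definition binary_coding (A : Type) (n k : nat) (nu : nat -> free_group n)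
    (c : A -> k.+1.-tuple bool) (y : free_group n -> A) : cantor_space :=
  fun i => nth false (c (y (nu (i %/ k.+1)))) (i %% k.+1).

Definition subshift_degree (G : groupType) (A : Type) (n k : nat)
    (s : 'I_n -> G) (nu : nat -> free_group n) (c : A -> k.+1.-tuple bool)
    (X : set (G -> A)) : set (set cantor_space) :=
  medvedev_degree [set binary_coding nu c y | y in pullback s X].

(* The degree of a subshift depends neither on s, nor on nu, nor on c, so    *)
(* letting these range over all choices adds no new degree.                  *)
Definition medvedev_SFT (G : groupType) : set (set (set cantor_space)) :=
  [set D | exists (n : nat) (s : 'I_n -> G) (nu : nat -> free_group n)
             (A : finType) (k : nat) (c : A -> k.+1.-tuple bool)
             (X : set (G -> A)),
     [/\ generating s, computable_bijection nu & injective c] /\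
     [/\ SFT X, X !=set0 & D = subshift_degree s nu c X]].

(* Main.v *)
(* The heart is a construction turning a G-SFT X into an H-SFT Y of the same
   degree, from a computable quasi-isometry f : G -> H, when G is finitely
   presented.  Let r be a computable quasi-inverse of f.  The map
   g |-> (f g, (r (f g))^-1 * g) embeds G into H * V for a finite V, and right
   multiplication by a generator of G moves points of the image by a bounded
   amount in H.  A configuration of Y records which points of H * V are live, a
   letter of the alphabet of X at each live point, and for each generator of G a
   move to another live point.  Finitely many local rules say that the moves of
   inverse generators cancel, that the relators of G move nothing, that no pattern
   forbidden in X can be read along the moves, and that every ball of some fixed
   radius contains a live point.  The moves then define a right action of G on the
   live points, so reading letters along the orbit of any live point gives a
   configuration of X; conversely each x in X is encoded through the embedding.
   Both translations are computable because the word problems are decidable.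
   Finite presentation is needed only on the side of X, so the reverse inclusion
   follows by applying the construction to r. *)
Require Import Defs.
From HB Require Import structures.
From Stdlib Require Cantor.
From mathcomp Require Import all_boot order ssralg ssrnum archimedean finmap zify.
From mathcomp Require Import boolp classical_sets Rstruct.

Set Implicit Arguments.
Unset Strict Implicit.
Unset Printing Implicit Defensive.

Import Order.TTheory Num.Theory.

(** * Computable functions relative to a family of oracles *)

Definition nfst n := (Cantor.of_nat n).1.
Definition nsnd n := (Cantor.of_nat n).2.

Lemma nfstK x y : nfst (npair x y) = x.
Proof. by rewrite /nfst /npair Cantor.cancel_of_to. Qed.

Lemma nsndK x y : nsnd (npair x y) = y.
Proof. by rewrite /nsnd /npair Cantor.cancel_of_to. Qed.

Lemma npairK n : npair (nfst n) (nsnd n) = n.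
Proof. by rewrite /npair /nfst /nsnd -surjective_pairing Cantor.cancel_to_of. Qed.

Lemma leq_npair x y : (x + y <= npair x y)%N.
Proof. by have := Cantor.to_nat_non_decreasing x y; rewrite /npair; lia. Qed.

Definition nE := (nfstK, nsndK).

(** Inverse of [seq_code], with fuel [k]. The code itself is enough fuel: [npair] dominates both
    arguments, so each tail has a strictly smaller code. *)
Fixpoint decode_rec k c : seq nat :=
  if k is k'.+1 then
    if c is c'.+1 then nfst c' :: decode_rec k' (nsnd c') else [::]
  else [::].

Definition decode c := decode_rec c c.

Lemma decode_recK k c : c <= k -> seq_code (decode_rec k c) = c.
Proof.
elim: k c => [|k IHk] [|c] //= le_ck.
by rewrite IHk ?npairK //; have := leq_npair (nfst c) (nsnd c); rewrite npairK; lia.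
Qed.

Lemma decodeK : cancel decode seq_code.
Proof. by move=> c; apply: decode_recK. Qed.

Lemma seq_code_recK k l : seq_code l <= k -> decode_rec k (seq_code l) = l.
Proof.
elim: l k => [|a l IHl] [|k] //=.
by rewrite !nE ltnS => le_k; rewrite IHl //; have := leq_npair a (seq_code l); lia.
Qed.

Lemma seq_codeK : cancel seq_code decode.
Proof. by move=> l; apply: seq_code_recK. Qed.

Lemma size_decode c : (size (decode c) <= c)%N.
Proof.
rewrite -{2}[c]decodeK; elim: (decode c) => //= a l IHl.
by have := leq_npair a (seq_code l); lia.
Qed.

Lemma decodeS c : decode c.+1 = nfst c :: decode (nsnd c).
Proof.
by apply: (can_inj seq_codeK); rewrite decodeK /= decodeK npairK.
Qed.

(** Composition of functionals: each oracle call of [p] is answered by running [q]. With [q = Zero]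
    it runs an oracle-free program in the presence of any oracle. *)
Fixpoint oracle_subst (q p : prog) : prog :=
  match p with
  | Oracle => q
  | Pair f g => Pair (oracle_subst q f) (oracle_subst q g)
  | Comp f g => Comp (oracle_subst q f) (oracle_subst q g)
  | PrimRec f g => PrimRec (oracle_subst q f) (oracle_subst q g)
  | Mu f => Mu (oracle_subst q f)
  | _ => p
  end.

Lemma eval_oracle_subst (o o' : nat -> bool) q p x y :
  (forall n, eval o q n (o' n)) -> eval o' p x y -> eval o (oracle_subst q p) x y.
Proof.
move=> qP; elim: p x y => //=.
- by move=> x y ->.
- by move=> f IHf g IHg x y [u [v [/IHf fu /IHg gv ->]]]; exists u, v.
- by move=> f IHf g IHg x y [z /IHg gz /IHf fz]; exists z.
- move=> f IHf g IHg x y; case: (Cantor.of_nat x) => a n.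
  by elim: n y => [|n IHn] y; [exact: IHf | case=> r /IHn ? /IHg ?; exists r].
- by move=> f IHf x y [/IHf ? lt]; split=> // k /lt[v /IHf ?]; exists v.
Qed.

Section Computable.
Variables (I : Type) (o : I -> nat -> bool).
Implicit Types (f g h : I -> nat -> nat) (P Q : I -> nat -> bool).

(** One program serves all indices. The index will range over the points of a subshift, and Medvedev
    reducibility asks for a single functional on all of them. *)
Definition comp f := exists p, forall i n, eval (o i) p n (f i n).
Definition dec P := comp (fun i n => P i n : nat).

Lemma comp_ext g f : f =2 g -> comp g -> comp f.
Proof. by move=> fg [p pP]; exists p => i n; rewrite fg. Qed.

Lemma dec_ext Q P : P =2 Q -> dec Q -> dec P.
Proof. by move=> PQ; apply: comp_ext => i n; rewrite PQ. Qed.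

Lemma comp_fst : comp (fun _ => nfst). Proof. by exists Fst. Qed.
Lemma comp_snd : comp (fun _ => nsnd). Proof. by exists Snd. Qed.
Lemma dec_oracle : dec o. Proof. by exists Oracle. Qed.

Lemma comp_app f g : comp f -> comp g -> comp (fun i n => f i (g i n)).
Proof. by move=> [p pP] [q qP]; exists (Comp p q) => i n; exists (g i n). Qed.

Lemma comp_pair f g : comp f -> comp g -> comp (fun i n => npair (f i n) (g i n)).
Proof. by move=> [p pP] [q qP]; exists (Pair p q) => i n; exists (f i n), (g i n). Qed.

Lemma comp_id : comp (fun _ n => n).
Proof.
by apply: comp_ext (comp_pair comp_fst comp_snd) => i n; rewrite npairK.
Qed.

Lemma comp_nfst f : comp f -> comp (fun i n => nfst (f i n)).
Proof. exact: comp_app comp_fst. Qed.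

Lemma comp_nsnd f : comp f -> comp (fun i n => nsnd (f i n)).
Proof. exact: comp_app comp_snd. Qed.

Lemma comp_succ f : comp f -> comp (fun i n => (f i n).+1).
Proof. by apply: (@comp_app (fun _ => succn)); exists Succ. Qed.

Lemma comp_const k : comp (fun _ _ => k).
Proof. by elim: k => [|k /comp_succ //]; exists Zero. Qed.

Lemma comp_rec f g h : comp f -> comp g -> comp h ->
  comp (fun i n => nat_rec (fun=> nat) (f i n)
                     (fun k r => g i (npair n (npair k r))) (h i n)).
Proof.
move=> [p pP] [q qP] comp_h.
have comp_r : comp (fun i n => nat_rec (fun=> nat) (f i (nfst n))
    (fun k r => g i (npair (nfst n) (npair k r))) (nsnd n)).
  exists (PrimRec p q) => i n /=; rewrite /nfst /nsnd.
  case: (Cantor.of_nat n) => a m /=; elim: m => //= m IHm.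
  by set r := nat_rec _ _ _ _ in IHm *; exists r.
apply: comp_ext (comp_app comp_r (comp_pair comp_id comp_h)) => i n.
by rewrite !nE.
Qed.

Lemma comp_iter f g h : comp f -> comp g -> comp h ->
  comp (fun i n => iter (h i n) (fun r => g i (npair n r)) (f i n)).
Proof.
move=> cf cg ch.
have cg' : comp (fun i n => g i (npair (nfst n) (nsnd (nsnd n)))).
  by apply: (comp_app cg (comp_pair comp_fst (comp_nsnd comp_snd))).
apply: comp_ext (comp_rec cf cg' ch) => i n.
by elim: (h i n) => //= m <-; rewrite !nE.
Qed.

(** The truth value is used as an iteration count: no round leaves [g], one round overwrites it by
    [f]. *)
Lemma comp_if P f g : dec P -> comp f -> comp g ->
  comp (fun i n => if P i n then f i n else g i n).
Proof.
move=> cP cf cg; apply: comp_ext (comp_iter cg (comp_app cf comp_fst) cP) => i n.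
by case: (P i n); rewrite /= ?nE.
Qed.

Lemma comp_pred f : comp f -> comp (fun i n => (f i n).-1).
Proof.
move=> cf.
apply: comp_ext (comp_rec (comp_const 0) (comp_nfst comp_snd) cf) => i n.
by case: (f i n) => //= m; rewrite !nE.
Qed.

Lemma comp_addn f g : comp f -> comp g -> comp (fun i n => f i n + g i n).
Proof.
move=> cf cg; apply: comp_ext (comp_iter cg (comp_succ comp_snd) cf) => i n.
by elim: (f i n) => //= m <-; rewrite nE.
Qed.

Lemma comp_subn f g : comp f -> comp g -> comp (fun i n => f i n - g i n).
Proof.
move=> cf cg; apply: comp_ext (comp_iter cf (comp_pred comp_snd) cg) => i n.
by elim: (g i n) => [|m IHm] /=; rewrite ?subn0 // nE subnS IHm.
Qed.

Lemma comp_muln f g : comp f -> comp g -> comp (fun i n => f i n * g i n).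
Proof.
move=> cf cg.
apply: comp_ext (comp_iter (comp_const 0)
  (comp_addn (comp_app cg comp_fst) comp_snd) cf) => i n.
by elim: (f i n) => //= m <-; rewrite !nE mulSn.
Qed.

Lemma dec_eq0 f : comp f -> dec (fun i n => f i n == 0).
Proof.
move=> cf; apply: comp_ext (comp_subn (comp_const 1) cf) => i n.
by case: (f i n).
Qed.

Lemma dec_not P : dec P -> dec (fun i n => ~~ P i n).
Proof. by move/dec_eq0; apply: dec_ext => i n; case: (P i n). Qed.

Lemma dec_and P Q : dec P -> dec Q -> dec (fun i n => P i n && Q i n).
Proof. by move=> cP cQ; apply: comp_ext (comp_muln cP cQ) => i n; rewrite mulnb. Qed.

Lemma dec_or P Q : dec P -> dec Q -> dec (fun i n => P i n || Q i n).
Proof.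
move=> /dec_not cP /dec_not cQ; have := dec_not (dec_and cP cQ).
by apply: dec_ext => i n; rewrite negb_and !negbK.
Qed.

Lemma dec_const b : dec (fun _ _ => b). Proof. exact: comp_const. Qed.

Lemma dec_app P f : dec P -> comp f -> dec (fun i n => P i (f i n)).
Proof. exact: (@comp_app (fun i n => P i n)). Qed.

Lemma dec_all (T : Type) (l : seq T) (P : T -> I -> nat -> bool) :
  (forall t, dec (P t)) -> dec (fun i n => all (fun t => P t i n) l).
Proof.
by move=> cP; elim: l => [|t l IHl] /=; [apply: dec_const | apply: dec_and].
Qed.

Lemma dec_has (T : Type) (l : seq T) (P : T -> I -> nat -> bool) :
  (forall t, dec (P t)) -> dec (fun i n => has (fun t => P t i n) l).
Proof.
by move=> cP; elim: l => [|t l IHl] /=; [apply: dec_const | apply: dec_or].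
Qed.

Lemma dec_leq f g : comp f -> comp g -> dec (fun i n => f i n <= g i n).
Proof. by move=> cf cg; apply: dec_eq0 (comp_subn cf cg). Qed.

Lemma dec_eqn f g : comp f -> comp g -> dec (fun i n => f i n == g i n).
Proof.
move=> cf cg; apply: dec_ext (dec_and (dec_leq cf cg) (dec_leq cg cf)) => i n.
by rewrite eqn_leq.
Qed.

(** Unbounded search. Minimality of the witness is recorded because it makes later choices
    canonical. *)
Lemma comp_mu P : dec P -> (forall i n, exists k, P i (npair n k)) ->
  exists2 f, comp f & forall i n, P i (npair n (f i n)) /\
                                  forall k, P i (npair n k) -> f i n <= k.
Proof.
move=> /dec_not[p pP] exP; exists (fun i n => ex_minn (exP i n)).
  exists (Mu p) => i n /=; case: ex_minnP => m Pm minm; split.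
    by have := pP i (npair n m); rewrite Pm.
  move=> k ltkm; exists 0; have := pP i (npair n k).
  by case Pk: (P i _) => //; have := minm _ Pk; lia.
by move=> i n; case: ex_minnP.
Qed.

Lemma comp_computes p f g : comp f ->
  (forall i n, computes p (f i n) (g i n)) -> comp g.
Proof.
move=> [q qP] pP; exists (Comp (oracle_subst Zero p) q) => i n /=.
by exists (f i n) => //; apply: eval_oracle_subst (pP i n).
Qed.

Lemma comp_divn f k : 0 < k -> comp f -> comp (fun i n => f i n %/ k).
Proof.
move=> k_gt0 cf.
pose P (i : I) n := f i (nfst n) < (nsnd n).+1 * k.
have [||g cg gP] := @comp_mu P.
- apply: (@dec_leq (fun i n => (f i (nfst n)).+1)).
    exact: comp_succ (comp_app cf comp_fst).
  exact: comp_muln (comp_succ comp_snd) (comp_const k).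
- by move=> i n; exists (f i n %/ k); rewrite /P !nE ltn_ceil.
apply: comp_ext cg => i n; case: (gP i n); rewrite /P !nE => lt_f minf.
apply/eqP; rewrite eqn_leq -ltnS ltn_divLR // lt_f /=.
by apply: minf; rewrite !nE ltn_ceil.
Qed.

Lemma comp_modn f k : 0 < k -> comp f -> comp (fun i n => f i n %% k).
Proof.
move=> k_gt0 cf; have := comp_subn cf (comp_muln (comp_divn k_gt0 cf) (comp_const k)).
by apply: comp_ext => i n; rewrite {2}(divn_eq (f i n) k) addKn.
Qed.

Lemma comp_foldl (step : I -> nat -> nat -> nat -> nat) f g :
  comp (fun i n => step i (nfst n) (nfst (nsnd n)) (nsnd (nsnd n))) ->
  comp f -> comp g ->
  comp (fun i n => foldl (step i n) (f i n) (decode (g i n))).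
Proof.
move=> cstep cf cg.
(* [next] acts on pairs (code of the letters still to be read, accumulator). *)
pose next i n := let l := nfst (nsnd n) in let st := nsnd (nsnd n) in
  if l == 0 then nsnd n
  else npair (nsnd l.-1) (step i (nfst n) st (nfst l.-1)).
have cl : comp (fun _ n => nfst (nsnd n)) := comp_nfst comp_snd.
have cst : comp (fun _ n => nsnd (nsnd n)) := comp_nsnd comp_snd.
have cnext : comp next.
  apply: comp_if (dec_eq0 cl) comp_snd (comp_pair (comp_nsnd (comp_pred cl)) _).
  have cp := comp_pair comp_fst (comp_pair cst (comp_nfst (comp_pred cl))).
  by apply: comp_ext (comp_app cstep cp) => i n; rewrite !nE.
apply: comp_ext (comp_nsnd (comp_iter (comp_pair cg cf) cnext cg)) => i n.
(* The number of rounds is the code of the list, which is at least its length; surplus rounds leave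
   the state fixed. *)
have := size_decode (g i n); move: {2 4}(g i n) => k.
elim: k (g i n) (f i n) => [|k IHk] c st.
  by case: c => [|c] /=; rewrite ?decodeS ?nE.
rewrite iterSr; case: c => [_|c].
  by rewrite {2}/next !nE /= -(IHk 0).
by rewrite decodeS /= ltnS => /IHk->; rewrite {3}/next /= !nE.
Qed.

Lemma comp_catrev f g : comp f -> comp g ->
  comp (fun i n => seq_code (catrev (decode (f i n)) (decode (g i n)))).
Proof.
move=> cf cg.
have cs : comp (fun _ n => (npair (nsnd (nsnd n)) (nfst (nsnd n))).+1).
  apply: comp_succ (comp_pair _ _); first exact: comp_nsnd comp_snd.
  exact: comp_nfst comp_snd.
apply: comp_ext (comp_foldl (step := fun _ _ st a => (npair a st).+1) cs cg cf).
move=> i n; move: (g i n); elim: (decode _) => [|a l IHl] c /=; first exact: decodeK.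
by rewrite -IHl decodeS !nE.
Qed.

Lemma comp_cat f g : comp f -> comp g ->
  comp (fun i n => seq_code (decode (f i n) ++ decode (g i n))).
Proof.
move=> cf cg; apply: comp_ext (comp_catrev (comp_catrev cf (comp_const 0)) cg).
by move=> i n; rewrite seq_codeK !catrevE cats0 revK.
Qed.

Lemma comp_nth d (l : seq nat) f : comp f -> comp (fun i n => nth d l (f i n)).
Proof.
elim: l f => [|a l IHl] f cf.
  by apply: comp_ext (comp_const d) => i n; rewrite nth_nil.
apply: comp_ext (comp_if (dec_eq0 cf) (comp_const a) (IHl _ (comp_pred cf))) => i n.
by case: (f i n).
Qed.

Lemma comp_filter (p : pred nat) f : dec (fun _ n => p n) -> comp f ->
  comp (fun i n => seq_code [seq a <- decode (f i n) | p a]).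
Proof.
move=> cp cf.
have ca : comp (fun _ n => nsnd (nsnd n)) := comp_nsnd comp_snd.
have cst : comp (fun _ n => nfst (nsnd n)) := comp_nfst comp_snd.
have cs : comp (fun _ n => if p (nsnd (nsnd n))
    then (npair (nsnd (nsnd n)) (nfst (nsnd n))).+1 else nfst (nsnd n)).
  exact: comp_if (dec_app cp ca) (comp_succ (comp_pair ca cst)) cst.
have := comp_catrev (comp_foldl (step := fun _ _ st a => if p a
  then (npair a st).+1 else st) cs (comp_const 0) cf) (comp_const 0).
apply: comp_ext => i n; rewrite catrevE cats0.
have foldlE l c : decode (foldl (fun st a => if p a then (npair a st).+1 else st) c l)
    = catrev [seq a <- l | p a] (decode c).
  elim: l c => //= a l IHl c; rewrite IHl; case: ifP => //= _.
  by rewrite decodeS !nE.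
by rewrite foldlE catrevE cats0 revK.
Qed.

End Computable.

Definition recursive (f : nat -> nat) :=
  @comp unit (fun _ _ => false) (fun _ => f).

Lemma recursive_computes p f g : recursive f ->
  (forall n, computes p (f n) (g n)) -> recursive g.
Proof. by move=> rf pP; apply: (@comp_computes _ _ p _ _ rf). Qed.

(** * Computable functions with values in a finite type *)

Section FiniteValued.
Variables (I : Type) (o : I -> nat -> bool).
Implicit Types T U V : finType.

Lemma comp_recursive f g : recursive f -> comp o g -> comp o (fun i n => f (g i n)).
Proof. by move=> [p pP] cg; apply: (@comp_computes _ _ p _ _ cg) => i n; apply: pP tt _. Qed.

(** Decidability of each fibre is used so that no coding of [T] by numbers has to be fixed. *)
Definition fcomp T (y : I -> nat -> T) := forall t, dec o (fun i n => y i n == t).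

Lemma fcomp_ext T (z y : I -> nat -> T) : y =2 z -> fcomp z -> fcomp y.
Proof. by move=> yz cz t; apply: dec_ext (cz t) => i n; rewrite yz. Qed.

Lemma dec_fcomp T (y : I -> nat -> T) (p : pred T) :
  fcomp y -> dec o (fun i n => p (y i n)).
Proof.
move=> cy; have := dec_has (enum T) (fun t => dec_and (dec_const o (p t)) (cy t)).
apply: dec_ext => i n; apply/idP/hasP => [py | [t _ /andP[pt /eqP->]] //].
by exists (y i n); rewrite ?mem_enum ?py ?eqxx.
Qed.

Lemma fcomp_map T U (g : T -> U) (y : I -> nat -> T) :
  fcomp y -> fcomp (fun i n => g (y i n)).
Proof. by move=> cy u; apply: (dec_fcomp (fun t => g t == u) cy). Qed.

Lemma fcomp_app T (y : I -> nat -> T) f :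
  fcomp y -> comp o f -> fcomp (fun i n => y i (f i n)).
Proof. by move=> cy cf t; apply: dec_app (cy t) cf. Qed.

(** A function on a finite type is a finite table, hence computable even if its values were picked
    by choice. *)
Lemma comp_fcomp T (tbl : T -> nat) (y : I -> nat -> T) :
  fcomp y -> comp o (fun i n => tbl (y i n)).
Proof.
move=> cy.
have: comp o (fun i n => foldr (fun t r => if y i n == t then tbl t else r) 0 (enum T)).
  by elim: (enum T) => [|t l IHl] /=; [apply: comp_const | apply: comp_if => //; apply: comp_const].
apply: comp_ext => i n; have := mem_enum T (y i n); elim: (enum T) => //= t l IHl.
by rewrite inE; case: eqP => [->|_] //= /IHl.
Qed.

Lemma fcomp_if T P (y z : I -> nat -> T) : dec o P -> fcomp y -> fcomp z ->
  fcomp (fun i n => if P i n then y i n else z i n).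
Proof.
move=> cP cy cz t.
apply: dec_ext (dec_or (dec_and cP (cy t)) (dec_and (dec_not cP) (cz t))) => i n.
by case: (P i n); rewrite ?orbF.
Qed.

Lemma fcomp_const T (t : T) : fcomp (fun _ _ => t).
Proof. by move=> u; apply: dec_const. Qed.

Lemma fcomp_ffun V U (y : I -> nat -> {ffun V -> U}) :
  (forall v, fcomp (fun i n => y i n v)) -> fcomp y.
Proof.
move=> cy t; have := dec_all (enum V) (fun v => cy v (t v)).
apply: dec_ext => i n; apply/eqP/allP => [-> v _ // | yt].
by apply/ffunP => v; apply/eqP/yt; rewrite mem_enum.
Qed.

Lemma fcomp_pair T U (y : I -> nat -> T) (z : I -> nat -> U) :
  fcomp y -> fcomp z -> fcomp (fun i n => (y i n, z i n)).
Proof. by move=> cy cz [t u]; apply: dec_and. Qed.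

Lemma fcomp_nth T (t0 : T) (l : seq T) f :
  comp o f -> fcomp (fun i n => nth t0 l (f i n)).
Proof.
elim: l f => [|t l IHl] f cf.
  by apply: fcomp_ext (fcomp_const t0) => i n; rewrite nth_nil.
apply: fcomp_ext (fcomp_if (dec_eq0 cf) (fcomp_const t) (IHl _ (comp_pred cf))).
by move=> i n; case: (f i n).
Qed.

Lemma fcomp_pred T (R : T -> I -> nat -> bool) (y : I -> nat -> T) :
  (forall t, dec o (R t)) -> (forall i n t, R t i n = (y i n == t)) -> fcomp y.
Proof. by move=> cR RE t; apply: dec_ext (cR t) => i n; rewrite RE. Qed.

End FiniteValued.

Local Open Scope group_scope.

(** * Groups with computable numberings *)

Section Numbering.
Variable G : groupType.

(** Working form of a decidable word problem. Elements may have many codes; inverses are avoided by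
    comparing products. *)
Record numbering (e : nat -> G) : Prop := Numbering {
  numbering_surj : forall g, exists n, e n = g;
  numbering_mul : exists2 m, recursive m & forall a b, e (m (npair a b)) = e a * e b;
  numbering_eq : recursive (fun n => e (nfst n) == e (nsnd n)) }.

Variables (e : nat -> G) (eP : numbering e).

Lemma dec_numbering_eq (I : Type) (o : I -> nat -> bool) f g :
  comp o f -> comp o g -> dec o (fun i n => e (f i n) == e (g i n)).
Proof.
move=> cf cg; have := comp_recursive (numbering_eq eP) (comp_pair cf cg).
by apply: comp_ext => i n; rewrite !nE.
Qed.

Lemma numbering_word (L : seq G) : exists2 W, recursive W &
  forall l, e (W (seq_code l)) = \prod_(a <- l) nth 1 L a.
Proof.
have [m rm mE] := numbering_mul eP.
have [one oneE] := numbering_surj eP 1.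
have [c cE] : exists c, forall i, e (nth one c i) = nth 1 L i.
  elim: L => [|g L [c cE]]; first by exists [::] => i; rewrite !nth_nil.
  by have [k kE] := numbering_surj eP g; exists (k :: c) => -[|i] /=.
exists (fun l => foldl (fun st a => m (npair st (nth one c a))) one (decode l)).
  apply: (comp_foldl (step := fun _ _ st a => m (npair st (nth one c a)))).
  - apply: comp_recursive rm (comp_pair _ (comp_nth _ _ _)).
    + exact: comp_nfst (comp_snd _).
    + exact: comp_nsnd (comp_snd _).
  - exact: comp_const.
  - exact: comp_id.
have foldlE l st : e (foldl (fun st a => m (npair st (nth one c a))) st l)
    = e st * \prod_(a <- l) nth 1 L a.
  elim: l st => [|a l IHl] st /=; first by rewrite big_nil mulg1.
  by rewrite IHl mE cE big_cons mulgA.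
by move=> l; rewrite seq_codeK foldlE oneE mul1g.
Qed.

End Numbering.

(** * Words and numberings of groups *)

Section Words.
Variables (T : finType) (k : T -> nat).
Hypothesis k_inj : injective k.

Definition letter_of a := [pick t | k t == a].
(** Entries that code no letter are dropped, so every number denotes a word. *)
Definition word_of c := pmap letter_of (decode c).

Lemma letter_ofK : pcancel k letter_of.
Proof.
move=> t; rewrite /letter_of; case: pickP => [u /eqP/k_inj-> // | /(_ t)].
by rewrite eqxx.
Qed.

Lemma k_letter_of : ocancel letter_of k.
Proof. by move=> a; rewrite /letter_of; case: pickP => //= t /eqP. Qed.

Lemma word_ofK w : word_of (seq_code (map k w)) = w.
Proof. by rewrite /word_of seq_codeK map_pK //; apply: letter_ofK. Qed.

Lemma fcomp_letter_of (I : Type) (o : I -> nat -> bool) f :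
  comp o f -> fcomp o (fun i n => letter_of (f i n)).
Proof.
move=> cf; pose R (u : option T) i n := if u is Some t then k t == f i n
  else ~~ has (fun t => k t == f i n) (enum T).
apply: (@fcomp_pred _ _ _ R) => [[t|] | i n [t|]] /=.
- exact: dec_eqn (comp_const _ _) cf.
- by apply/dec_not/dec_has => t; apply: dec_eqn (comp_const _ _) cf.
- have [<- | neq] := eqVneq (k t) (f i n); first by rewrite letter_ofK eqxx.
  symmetry; apply: contraNF neq => /eqP Et.
  by have := k_letter_of (f i n); rewrite Et /= => ->.
- rewrite /letter_of; case: pickP => [t /eqP<- | none].
    by apply/negbTE/negPn/hasP; exists t; rewrite ?mem_enum /=.
  by rewrite eqxx; apply/hasPn => t _; rewrite none.
Qed.

(** Turns any number into a genuine word code, the only inputs on which the given programs are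
    specified. *)
Lemma recursive_norm : recursive (fun c => seq_code (map k (word_of c))).
Proof.
pose p a := isSome (letter_of a).
have cp : dec (fun (_ : unit) _ => false) (fun _ n => p n).
  exact: (dec_fcomp (fun u => isSome u) (fcomp_letter_of (comp_id _))).
apply: comp_ext (comp_filter cp (comp_id _)) => _ n /=.
congr seq_code; rewrite /word_of; elim: (decode n) => //= a l IHl.
rewrite [p a]/p; have := k_letter_of a.
by case: (letter_of a) => [t|] //= ->; rewrite IHl.
Qed.

Variables (G : groupType) (e : nat -> G) (eP : numbering e) (tau : T -> G).

Lemma numbering_eval : exists2 W, recursive W &
  forall c, e (W c) = \prod_(t <- word_of c) tau t.
Proof.
(* All letter codes lie below [N], so a list of length [N] tabulates [tau]. *)
pose N := (\max_t k t).+1.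
have [W rW WE] := numbering_word eP (mkseq (fun a => oapp tau 1 (letter_of a)) N).
exists W => // c; rewrite -{1}[c]decodeK WE /word_of.
elim: (decode c) => [|a l IHl] /=; first by rewrite !big_nil.
rewrite big_cons IHl; have := k_letter_of a.
case: (ltnP a N) => [ltaN|leNa].
  by rewrite nth_mkseq //; case: (letter_of a) => [t|] /= _; rewrite ?big_cons ?mul1g.
rewrite nth_default ?size_mkseq // mul1g.
case: (letter_of a) => //= t kt; move: leNa; rewrite -kt ltnNge.
by rewrite (leq_bigmax t).
Qed.

(** Search through all codes for a word with the right value: equality is decidable, and generation
    ensures termination. *)
Lemma word_search : (forall g, exists w, \prod_(t <- w) tau t = g) ->
  exists2 S, recursive S &
    forall m, exists2 w, S m = seq_code (map k w) & \prod_(t <- w) tau t = e m.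
Proof.
move=> gen; have [W rW WE] := numbering_eval.
have [||S cS SP] := @comp_mu unit (fun _ _ => false)
    (fun _ n => e (W (nsnd n)) == e (nfst n)).
- apply: dec_numbering_eq => //; last exact: comp_fst.
  exact: comp_recursive rW (comp_snd _).
- move=> _ n; have [w wE] := gen (e n); exists (seq_code (map k w)).
  by rewrite !nE WE word_ofK wE.
exists (fun m => seq_code (map k (word_of (S tt m)))).
  by apply: comp_recursive recursive_norm _; apply: comp_ext cS => -[].
move=> m; exists (word_of (S tt m)) => //.
by have [/eqP] := SP tt m; rewrite !nE WE.
Qed.

End Words.

(** Elements are numbered by words in the generators, and concatenation gives the product. *)
Lemma decidable_word_problem_numbering (G : groupType) :
  decidable_word_problem G -> exists e : nat -> G, numbering e.
Proof.
move=> [n [s [[_ sV gen] [p pP]]]].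
pose e c := \prod_(i <- word_of (@nat_of_ord n) c) s i; exists e.
have k_inj := @ord_inj n.
have surj g : exists c, e c = g.
  have [w <-] := gen g; exists (word_code w).
  by rewrite /e word_ofK.
pose m c := seq_code (decode (nfst c) ++ decode (nsnd c)).
have rm : recursive m by apply: comp_cat; [apply: comp_fst | apply: comp_snd].
have mE a b : e (m (npair a b)) = e a * e b.
  by rewrite /e /m /word_of seq_codeK !nE pmap_cat big_cat.
have r1 : recursive (fun c => e c == 1).
  apply: recursive_computes (recursive_norm k_inj) _ => c.
  have <- : `[< e c = 1 >] = (e c == 1).
    by apply/idP/idP => [/asboolP/eqP | /eqP/asboolP].
  exact: pP.
split=> //; first by exists m.
(* Equality reduces to triviality: [v] finds a word inverse to the second element, which is then
   multiplied onto the first. *)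
have [||v cv vP] := @comp_mu unit (fun _ _ => false)
    (fun _ c => e (m (npair (nfst c) (nsnd c))) == 1).
- by apply: (comp_recursive r1 (comp_recursive rm (comp_pair _ _)));
    [apply: comp_fst | apply: comp_snd].
- move=> _ c; have [d dE] := surj (e c)^-1; exists d.
  by rewrite !nE mE dE mulgV.
have cE : comp (fun (_ : unit) _ => false)
   (fun i c => e (m (npair (nfst c) (v i (nsnd c)))) == 1).
  apply: (comp_recursive r1 (comp_recursive rm (comp_pair _ _))).
    exact: comp_fst.
  exact: comp_app cv (comp_snd _).
apply: comp_ext cE => -[] c; congr nat_of_bool.
have [/eqP] := vP tt (nsnd c); rewrite !nE !mE => /(canRL (mulKg _)) -> _.
by rewrite mulg1 divg_eq1.
Qed.

Definition recursive_map (G H : groupType) (e : nat -> G) (e' : nat -> H) (f : G -> H) :=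
  exists2 F, recursive F & forall n, e' (F n) = f (e n).

(** Find a word for the element, apply the map on words, evaluate the result. *)
Lemma computable_map_recursive (G H : groupType) (e : nat -> G) (e' : nat -> H)
    m n (t : 'I_m -> G) (s : 'I_n -> H) (f : G -> H) :
  numbering e -> numbering e' -> symmetric_generating t ->
  computable_map t s f -> recursive_map e e' f.
Proof.
move=> eP e'P [_ _ gen] [F [[p pP] FE]].
have [S rS SE] := word_search (@ord_inj m) eP gen.
have [W rW WE] := numbering_eval (@nat_of_ord n) e'P s.
pose g c := word_code (F (word_of (@nat_of_ord m) (S c))).
have rg : recursive g.
  apply: recursive_computes rS _ => c; rewrite /g.
  by have [w -> _] := SE c; rewrite word_ofK; [apply: pP | apply: ord_inj].
exists (fun c => W (g c)) => [|c]; first exact: comp_recursive.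
have [w wS wE] := SE c.
by rewrite WE word_ofK ?wS ?word_ofK; [rewrite -wE; apply: FE | apply: ord_inj | apply: ord_inj].
Qed.

(** * Coded configurations and Medvedev reducibility *)

Local Open Scope classical_set_scope.

Definition letter_code n (l : letter n) : nat := ((val l.1).*2 + l.2)%N.

Lemma letter_code_inj n : injective (@letter_code n).
Proof.
move=> [i b] [j d]; rewrite /letter_code /= => E.
have bd : b = d by move: (congr1 odd E); rewrite !oddD !odd_double; case: b d {E} => -[].
congr (_, _) => //; apply: val_inj => /=.
by move: (congr1 half E); rewrite bd ![(_ + d)%N]addnC !half_bit_double.
Qed.

Section LetterEval.
Variables (G : groupType) (n : nat) (s : 'I_n -> G).

Definition letter_eval (l : letter n) : G := if l.2 then (s l.1)^-1 else s l.1.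

Lemma letter_evalV l : letter_eval (inv_letter l) = (letter_eval l)^-1.
Proof. by case: l => i []; rewrite /letter_eval /= ?invgK. Qed.

Lemma eval_cons_red l w :
  \prod_(a <- cons_red l w) letter_eval a = letter_eval l * \prod_(a <- w) letter_eval a.
Proof.
case: w => [|b w] /=; first by rewrite big_seq1 big_nil mulg1.
case: eqP => [-> | _]; last by rewrite big_cons.
by rewrite big_cons letter_evalV mulVKg.
Qed.

Lemma eval_mul_red u v : \prod_(a <- mul_red u v) letter_eval a =
  (\prod_(a <- u) letter_eval a) * \prod_(a <- v) letter_eval a.
Proof.
elim: u => [|l u IHu] /=; first by rewrite big_nil mul1g.
by rewrite eval_cons_red IHu big_cons mulgA.
Qed.

Lemma fg_evalM (x y : free_group n) : fg_eval s (x * y) = fg_eval s x * fg_eval s y.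
Proof. exact: eval_mul_red. Qed.

Definition reduce (u : seq (letter n)) : free_group n :=
  FreeGroup (reduced_mul u (isT : reduced [::])).

Lemma fg_eval_reduce u : fg_eval s (reduce u) = \prod_(a <- u) letter_eval a.
Proof. by rewrite [LHS]eval_mul_red big_nil mulg1. Qed.

End LetterEval.

(** * Reading and writing binary codes of configurations *)

Section Coding.
Variables (G : groupType) (e : nat -> G) (eP : numbering e).
Variables (n : nat) (s : 'I_n -> G) (nu : nat -> free_group n).
Variables (A : finType) (k : nat) (c : A -> k.+1.-tuple bool).
Hypothesis nu_bij : computable_bijection nu.
Variables (I : Type) (x : I -> G -> A).

Let code_of := (fun z : G -> A => binary_coding nu c (z \o fg_eval s)).

Lemma recursive_fg_eval :
  exists2 V, recursive V & forall j, e (V j) = fg_eval s (nu j).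
Proof.
have [_ [p pP]] := nu_bij.
have [W rW WE] := numbering_eval (@letter_code n) eP (letter_eval s).
exists (fun j => W (fg_code (nu j))).
  by apply: comp_recursive rW _; apply: recursive_computes pP; apply: comp_id.
by move=> j; rewrite WE word_ofK //; apply: letter_code_inj.
Qed.

(** A search finds an index [j] with [nu j] evaluating to the given element; the [j]-th block of
    bits determines the letter because [c] is injective. *)
Lemma fcomp_read (o := fun i => code_of (x i)) :
  generating s -> injective c -> fcomp o (fun i m => x i (e m)).
Proof.
move=> [_ gen] c_inj; have [V rV VE] := recursive_fg_eval.
have [[nu' _ nuK] _] := nu_bij.
have [||j rj jP] := @comp_mu unit (fun _ _ => false)
    (fun _ m => e (V (nsnd m)) == e (nfst m)).
- apply: dec_numbering_eq => //; last exact: comp_fst.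
  exact: comp_recursive rV (comp_snd _).
- by move=> _ m; have [w wE] := gen (e m); exists (nu' w); rewrite !nE VE nuK wE.
have {}jP m : fg_eval s (nu (j tt m)) = e m.
  by have [/eqP] := jP tt m; rewrite !nE VE.
have cj : comp o (fun _ m => j tt m).
  by apply: (@comp_recursive _ o (j tt) (fun _ m => m)) (comp_id _);
    apply: comp_ext rj => -[].
apply: (@fcomp_pred _ _ _ (fun a i m => all (fun r : 'I_k.+1 =>
  nth false (c a) r == o i (j tt m * k.+1 + r)%N) (enum 'I_k.+1))) => [a | i m a].
  apply: dec_all => r; have cr : dec o (fun i m => o i (j tt m * k.+1 + r)%N).
    apply: dec_app (dec_oracle o) (comp_addn (comp_muln cj _) _); exact: comp_const.
  case: (nth _ _ _); first by apply: dec_ext cr => i m; case: (o i _).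
  by apply: dec_ext (dec_not cr) => i m; case: (o i _).
have oE (r : 'I_k.+1) : o i (j tt m * k.+1 + r)%N = nth false (c (x i (e m))) r.
  rewrite /o /code_of /binary_coding divnMDl // divn_small // addn0 modnMDl.
  by rewrite modn_small //= jP.
apply/allP/eqP => [eqc | <- r _]; last by rewrite oE.
apply/c_inj/val_inj/(@eq_from_nth _ false); rewrite !size_tuple // => r lt_r.
have := eqc (Ordinal lt_r); rewrite oE mem_enum => /(_ isT)/eqP /= <- //.
Qed.

(** Bit [m] is the entry [m %% k.+1] of the block of number [m %/ k.+1]. *)
Lemma fcomp_write (o : I -> nat -> bool) : fcomp o (fun i m => x i (e m)) ->
  exists p, forall i, turing_functional p (o i) (code_of (x i)).
Proof.
move=> cx; have [V rV VE] := recursive_fg_eval.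
pose z i m := (x i (e (V (m %/ k.+1))), inord (m %% k.+1) : 'I_k.+1).
have cz : fcomp o z.
  apply: fcomp_pair.
    apply: fcomp_app cx (comp_recursive rV (comp_divn _ _)) => //; exact: comp_id.
  apply: (@fcomp_pred _ _ _ (fun (r : 'I_k.+1) i m => (m %% k.+1)%N == r)) => [r | i m r].
    by apply: dec_eqn (comp_modn _ (comp_id _)) (comp_const _ _).
  by rewrite -val_eqE /= inordK ?ltn_mod.
have [p pP] := dec_fcomp (fun ar : A * 'I_k.+1 => nth false (c ar.1) ar.2) cz.
exists p => i m; have := pP i m; rewrite /z /= VE inordK ?ltn_mod //.
Qed.

End Coding.

Lemma medvedev_le_trans P Q R :
  medvedev_le P Q -> medvedev_le Q R -> medvedev_le P R.
Proof.
move=> [p pP] [q qP]; exists (oracle_subst q p) => x /qP[y /pP[z Pz pz] qy].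
by exists z => // m; apply: eval_oracle_subst (pz m).
Qed.

Lemma medvedev_degree_eq P Q : medvedev_le P Q -> medvedev_le Q P ->
  medvedev_degree P = medvedev_degree Q.
Proof.
move=> PQ QP; apply/seteqP; split=> R [le_R ge_R]; split.
- exact: medvedev_le_trans QP le_R.
- exact: medvedev_le_trans ge_R PQ.
- exact: medvedev_le_trans PQ le_R.
- exact: medvedev_le_trans ge_R QP.
Qed.

(* The configurations [z i] are computable, uniformly in [i], from the [y i]. *)
Definition computable_from (G H : groupType) (e : nat -> G) (e' : nat -> H)
    (I : Type) (A B : finType) (y : I -> G -> A) (z : I -> H -> B) :=
  forall o : I -> nat -> bool,
    fcomp o (fun i m => y i (e m)) -> fcomp o (fun i m => z i (e' m)).

(** The index type is [X] itself, so uniformity in the index yields one functional on all coded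
    points. *)
Lemma coding_le (G H : groupType) (e : nat -> G) (e' : nat -> H)
    n (s : 'I_n -> G) nu (A : finType) k (c : A -> k.+1.-tuple bool)
    n' (s' : 'I_n' -> H) nu' (B : finType) k' (c' : B -> k'.+1.-tuple bool)
    (X : set (G -> A)) (Y : set (H -> B)) (z : {x | X x} -> H -> B) :
  numbering e -> numbering e' ->
  generating s -> computable_bijection nu -> injective c ->
  computable_bijection nu' ->
  (forall i, Y (z i)) -> computable_from e e' (fun i => sval i) z ->
  medvedev_le [set binary_coding nu' c' y | y in pullback s' Y]
              [set binary_coding nu c x | x in pullback s X].
Proof.
move=> eP e'P gen_s nu_bij c_inj nu'_bij Yz cz.
have := fcomp_read eP nu_bij (fun i : {x | X x} => sval i) gen_s c_inj.
move=> /cz/(fcomp_write e'P s' c' nu'_bij)[p pP].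
exists p => _ [_ [x Xx <-] <-]; pose i : {x | X x} := exist _ x Xx.
exists (binary_coding nu' c' (z i \o fg_eval s')); last exact: (pP i).
by exists (z i \o fg_eval s') => //; exists (z i) => //; apply: Yz.
Qed.

(** * Computable enumeration of a free group *)

Lemma fcomp_foldl (I : Type) (o : I -> nat -> bool) (S : finType) (s0 : S)
    (step : S -> nat -> S) f :
  (forall s, fcomp o (fun _ a => step s a)) -> comp o f ->
  fcomp o (fun i m => foldl step s0 (decode (f i m))).
Proof.
(* The states of the automaton are replaced by their ranks, to which the fold on numbers applies. *)
move=> cstep cf; pose rk (s : S) : nat := enum_rank s.
have rkK s : nth s0 (enum S) (rk s) = s by rewrite nth_enum_rank.
pose step' st a := rk (step (nth s0 (enum S) st) a).
have cstep' : comp o (fun _ m => step' (nfst (nsnd m)) (nsnd (nsnd m))).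
  apply: comp_fcomp; apply: (@fcomp_pred _ _ _ (fun t i m => has (fun s : S =>
    (nth s0 (enum S) (nfst (nsnd m)) == s) && (step s (nsnd (nsnd m)) == t)) (enum S))).
    move=> t; apply: dec_has => s; apply: dec_and.
      by apply: (fcomp_nth s0 (enum S) (comp_nfst (comp_snd _))).
    apply: (fcomp_app (cstep s) (comp_nsnd (comp_snd _))).
  move=> i m t; apply/hasP/idP => [[s _ /andP[/eqP-> //]] | st].
  by exists (nth s0 (enum S) (nfst (nsnd m))); rewrite ?mem_enum ?eqxx.
have cfold := comp_foldl (step := fun _ _ => step') cstep' (comp_const o (rk s0)) cf.
apply: fcomp_ext (fcomp_nth s0 (enum S) cfold) => i m.
move: {1 3}s0 {cfold}; elim: (decode _) => [|a l IHl] s /=; first by rewrite rkK.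
by rewrite IHl /step' rkK.
Qed.

(** Members are listed in increasing order by searching for the next one. Strict growth gives
    injectivity, and minimality of the search means that none is skipped. *)
Lemma recursive_enumeration (P : pred nat) : dec (fun (_ : unit) _ => false) (fun _ n => P n) ->
  (forall m, exists2 c, m <= c & P c)%N ->
  exists q, [/\ recursive q, injective q, forall k, P (q k) & forall c, P c -> exists k, q k = c].
Proof.
move=> rP infP.
have [||nx rnx nxP] := @comp_mu unit (fun _ _ => false)
  (fun _ m => P (nsnd m) && (nfst m <= nsnd m)%N).
- by apply: dec_and (dec_app rP (comp_snd _)) (dec_leq (comp_fst _) (comp_snd _)).
- by move=> _ m; have [c le_mc Pc] := infP m; exists c; rewrite !nE Pc.
pose q k := iter k (fun r => nx tt r.+1) (nx tt 0).
have qS k : q k.+1 = nx tt (q k).+1 by [].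
have Pq k : P (q k).
  by case: k => [|k]; [have [] := nxP tt 0 | have [] := nxP tt (q k).+1]; rewrite !nE => /andP[].
have ltq k : (q k < q k.+1)%N.
  by rewrite qS; have [] := nxP tt (q k).+1; rewrite !nE => /andP[].
have leq_q k : (k <= q k)%N by elim: k => // k /leq_ltn_trans-> //.
have q_mono : {homo q : j k / (j < k)%N}.
  by apply: homo_ltn ltq => ? ? ?; apply: ltn_trans.
exists q; split=> //.
- apply: (@comp_ext _ _ (fun _ k => iter k (fun r => nx tt (nsnd (npair k r)).+1) (nx tt 0))).
    by move=> _ k; rewrite /q; apply: eq_iter => r; rewrite nE.
  apply: (@comp_iter unit (fun _ _ => false) _ (fun i m => nx tt (nsnd m).+1)).
  + by apply: comp_ext (comp_app rnx (comp_const _ 0)) => -[].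
  + by apply: comp_ext (comp_app rnx (comp_succ (comp_snd _))) => -[].
  + exact: comp_id.
- move=> j k; case: (ltngtP j k) => // /q_mono; last by move=> + E; rewrite E ltnn.
  by move=> + E; rewrite E ltnn.
- move=> c Pc.
  have: forall k, (exists j, q j = c) \/ (q k <= c)%N.
    elim=> [|k [? | le_qc]]; [| by left |].
      by right; have [_] := nxP tt 0; apply; rewrite !nE Pc.
    case: (ltngtP (q k) c) le_qc => // [lt_qc _ | ? _]; last by left; exists k.
    by right; have [_] := nxP tt (q k).+1; apply; rewrite !nE Pc.
  by move=> /(_ c.+1)[] // /(leq_trans (leq_q _)); rewrite ltnn.
Qed.

(** An automaton remembering the last letter and the verdict so far recognises reduced words. *)
Lemma reduced_foldl n (w : seq (letter n)) :
  reduced w = (foldl (fun st l => (Some l,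
    st.2 && if st.1 is Some a then l != inv_letter a else true)) (None, true) w).2.
Proof.
case: w => //= a w; rewrite /reduced /=.
have stE b u c : (foldl (fun (st : option (letter n) * bool) l => (Some l,
    st.2 && if st.1 is Some a then l != inv_letter a else true)) (Some c, b) u).2
    = b && path (fun a b => b != inv_letter a) c u.
  by elim: u b c => [|d u IHu] b c /=; rewrite ?andbT // IHu andbA.
by rewrite stE.
Qed.

(** The normal codes of reduced words form a decidable set, infinite since the rank is positive; it
    is enumerated without repetition. *)
Lemma computable_bijection_exists n :
  exists nu : nat -> free_group n.+1, computable_bijection nu.
Proof.
pose k := @letter_code n.+1; have k_inj : injective k := @letter_code_inj n.+1.
pose valid c := (seq_code (map k (word_of k c)) == c) && reduced (word_of k c).
have [||q [rq q_inj qP q_surj]] := @recursive_enumeration valid.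
- apply: dec_and.
    exact: (dec_eqn (recursive_norm k_inj) (comp_id _)).
  pose step (st : option (letter n.+1) * bool) a := if letter_of k a is Some l then
    (Some l, st.2 && if st.1 is Some b then l != inv_letter b else true) else st.
  have cstep st : fcomp (fun (_ : unit) _ => false) (fun _ a => step st a).
    have := fcomp_letter_of k_inj (comp_id (fun (_ : unit) _ => false)).
    by move/(fcomp_map (fun u => if u is Some l then (Some l, st.2 &&
      if st.1 is Some b then l != inv_letter b else true) else st)).
  have := fcomp_foldl (None, true) cstep (comp_id _).
  move/(dec_fcomp snd); apply: dec_ext => _ c.
  rewrite reduced_foldl /word_of; move: (None, true) => st.
  elim: (decode c) st => //= a l IHl st.
  by case E: (letter_of k a) => [u|] /=; rewrite IHl /step E.
(* Powers of the first generator have arbitrarily large codes. *)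
- move=> m; pose w := nseq m (ord0 : 'I_n.+1, false).
  exists (seq_code (map k w)).
    have -> : m = size w by rewrite size_nseq.
    elim: w => //= a w IHw; rewrite ltnS; apply: leq_trans IHw _.
    by apply: leq_trans (leq_npair (k a) _); rewrite leq_addl.
  rewrite /valid word_ofK // eqxx /reduced /w.
  by case: m {w} => //= m; elim: m => //= m ->; rewrite andbT.
pose nu j : free_group n.+1 := FreeGroup (proj2 (andP (qP j))).
have nuE j : fg_code (nu j) = q j by have /andP[/eqP] := qP j.
have nu_surj (w : free_group n.+1) : exists j, nu j == w.
  have [|j qj] := q_surj (fg_code w).
    by rewrite /valid /fg_code word_ofK // eqxx; apply: fg_reduced.
  exists j; apply/eqP/val_inj => /=; rewrite qj; exact: word_ofK.
exists nu; split; last first.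
  have [p pP] := rq; exists p => j; rewrite nuE; exact: (pP tt).
exists (fun w => xchoose (nu_surj w)) => [j | w]; last exact/eqP/(xchooseP (nu_surj w)).
by apply: q_inj; rewrite -2!nuE; congr fg_code; apply/eqP/(xchooseP (nu_surj (nu j))).
Qed.

(** * Coarse equivalences *)

(** Quasi-isometry without metrics: finite sets of displacements replace the constants. *)
Record coarse_equivalence (G H : groupType) (f : G -> H) : Prop := CoarseEquivalence {
  coarse_bornologous : forall P : seq G, exists Q : seq H, forall g g',
    g^-1 * g' \in P -> (f g)^-1 * f g' \in Q;
  coarse_proper : forall Q : seq H, exists P : seq G, forall g g',
    (f g)^-1 * f g' \in Q -> g^-1 * g' \in P;
  coarse_dense : exists K : seq H, forall h, exists g, (f g)^-1 * h \in K }.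

Section WordLength.
Variables (G : groupType) (n : nat) (s : 'I_n -> G).
Hypothesis gen : symmetric_generating s.

Lemma word_lengthP g : exists2 w, word_eval s w = g & size w = word_length s g.
Proof.
have [_ _ /(_ g)[w wE]] := gen.
have exk : exists k, `[< exists2 w, word_eval s w = g & size w = k >].
  by exists (size w); apply/asboolP; exists w.
have [k /asboolP wk mink] := ex_minnP exk.
rewrite /word_length; case: xgetP => [_ -> [] // | /(_ k)[]].
by split=> // u uE; apply: mink; apply/asboolP; exists u.
Qed.

Lemma ball_finite r : exists P : seq G, forall g, (word_length s g <= r)%N -> g \in P.
Proof.
exists (flatten [seq [seq word_eval s (tval w) | w : k.-tuple 'I_n] | k <- iota 0 r.+1]).
move=> g; have [w wE <-] := word_lengthP g => le_r.
apply/flatten_mapP; exists (size w); first by rewrite mem_iota.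
by apply/mapP; exists (in_tuple w); rewrite ?mem_enum.
Qed.

Lemma word_length_bounded (P : seq G) :
  exists r, forall g, g \in P -> (word_length s g <= r)%N.
Proof.
exists (\max_(g <- P) word_length s g)%N => g gP.
by rewrite (big_rem g) //= leq_maxl.
Qed.

End WordLength.

(** Balls are finite and finite sets lie in balls, so metric bounds and finite sets of displacements
    are interchangeable. *)
Lemma quasi_isometry_coarse (G H : groupType) m n (t : 'I_m -> G) (s : 'I_n -> H) f :
  symmetric_generating t -> symmetric_generating s -> quasi_isometry t s f ->
  coarse_equivalence f.
Proof.
move=> gen_t gen_s [C [C1 qi dense]].
have C_gt0 : (0 < C)%R by apply: lt_le_trans C1; apply: ltr01.
have bound (x : Rdefinitions.R) : exists N, forall k : nat, (k%:R <= x)%R -> (k <= N)%N.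
  exists (Num.Def.archi_bound `|x|%R) => k /le_trans/(_ (ler_norm x)) le_kx.
  by apply: ltnW; rewrite -(ltr_nat Rdefinitions.R) (le_lt_trans le_kx) // archi_boundP.
split.
- move=> P; have [r rP] := word_length_bounded t P.
  have [N NP] := bound (C * r%:R + C)%R.
  have [Q QP] := ball_finite gen_s N; exists Q => g g' /rP le_r; apply/QP/NP.
  have /andP[_] := qi g g'; move/le_trans; apply.
  by rewrite lerD2r ler_pM2l // ler_nat.
- move=> Q; have [r rQ] := word_length_bounded s Q.
  have [N NP] := bound (C * (r%:R + C))%R.
  have [P PP] := ball_finite gen_t N; exists P => g g' /rQ le_r; apply/PP/NP.
  have /andP[+ _] := qi g g'; rewrite lerBlDr ler_pdivrMl // => /le_trans; apply.
  by rewrite ler_pM2l // lerD2r ler_nat.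
have [N NP] := bound C; have [K KP] := ball_finite gen_s N.
exists (map (fun k => k^-1) K) => h; have [g le_g] := dense h; exists g.
apply/mapP; exists (h^-1 * f g); last by rewrite invgM invgK.
by apply/KP/NP.
Qed.

Definition mulseq (G : groupType) (P Q : seq G) : seq G := [seq p * q | p <- P, q <- Q].

Lemma mem_mulseq (G : groupType) (P Q : seq G) p q :
  p \in P -> q \in Q -> p * q \in mulseq P Q.
Proof. by move=> pP qQ; apply/allpairsP; exists (p, q). Qed.

(* Take for [r h] the element of least code among those that [f] sends
   close to [h]; minimality makes it independent of the code of [h]. *)
Lemma quasi_inverse (G H : groupType) (e : nat -> G) (e' : nat -> H) (f : G -> H) :
  numbering e -> numbering e' -> recursive_map e e' f -> coarse_equivalence f ->
  exists r : H -> G, [/\ recursive_map e' e r, coarse_equivalence r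
    & exists K : seq H, forall h, (f (r h))^-1 * h \in K].
Proof.
move=> eP e'P [F rF FE] [fb fp [K KP]].
have [m rm mE] := numbering_mul e'P.
have [||S rS SP] := @comp_mu unit (fun _ _ => false)
  (fun _ n => (f (e (nsnd n)))^-1 * e' (nfst n) \in K).
- have : dec (fun (_ : unit) _ => false) (fun _ n =>
      has (fun k => e' (nfst n) == f (e (nsnd n)) * k) K).
    apply: dec_has => k; have [c <-] := numbering_surj e'P k.
    have := dec_numbering_eq e'P (comp_fst (fun (_ : unit) _ => false))
      (comp_recursive rm (comp_pair (comp_recursive rF (comp_snd _)) (comp_const _ c))).
    by apply: dec_ext => _ n; rewrite mE FE.
  apply: dec_ext => _ n; apply/idP/hasP => [kK | [k kK /eqP->]]; last by rewrite mulKg.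
  by exists ((f (e (nsnd n)))^-1 * e' (nfst n)); rewrite ?mulVKg.
- move=> _ n; have [g gK] := KP (e' n); have [c cE] := numbering_surj eP g.
  by exists c; rewrite !nE cE.
have SE a b : e' a = e' b -> S tt a = S tt b.
  move=> ab; apply/eqP; rewrite eqn_leq.
  have [Sa mina] := SP tt a; have [Sb minb] := SP tt b; move: Sa mina Sb minb; rewrite !nE ab.
  by move=> Sa mina Sb minb; rewrite mina ?minb ?nE ?ab.
have [c cE] := choice (numbering_surj e'P).
pose r h := e (S tt (c h)).
have rK h : (f (r h))^-1 * h \in K.
  by have [] := SP tt (c h); rewrite !nE cE.
exists r; split; last by exists K.
  by exists (S tt) => [|n]; [apply: comp_ext rS => -[] | rewrite /r (SE _ n) // cE].
split.
(* The displacement from [f (r h)] to [f (r h')] passes through [h] and [h']; both end pieces come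
   from [K]. *)
- move=> P; have [Q QP] := fp (mulseq (mulseq K P) (map inv K)).
  exists Q => h h' hP; apply: QP.
  have <- : (f (r h))^-1 * h * (h^-1 * h') * ((f (r h'))^-1 * h')^-1 =
      (f (r h))^-1 * f (r h') by rewrite invgM invgK !mulgA !mulgK.
  by rewrite !mem_mulseq ?map_f.
- move=> P; have [Q QP] := fb P.
  exists (mulseq (mulseq (map inv K) Q) K) => h h' /QP hQ.
  have <- : ((f (r h))^-1 * h)^-1 * ((f (r h))^-1 * f (r h')) *
      ((f (r h'))^-1 * h') = h^-1 * h' by rewrite invgM invgK -!mulgA !mulVKg.
  by rewrite !mem_mulseq ?map_f.
- have [P PP] := fp K; exists P => g; exists (f g); apply: PP; exact: rK.
Qed.

(** * The subshift simulating a G-SFT on H *)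

Section Local.
Variables (H : groupType) (B : finType).

Definition local (T : Type) (a : (H -> B) -> T) :=
  exists Q : seq H, forall z z' : H -> B, {in Q, z =1 z'} -> a z = a z'.

Lemma local_const (T : Type) (t : T) : local (fun=> t).
Proof. by exists [::]. Qed.

Lemma local_at h : local (fun z => z h).
Proof. by exists [:: h] => z z' -> //; rewrite mem_head. Qed.

Lemma local_op2 (T U W : Type) (op : T -> U -> W) a b :
  local a -> local b -> local (fun z => op (a z) (b z)).
Proof.
move=> [Q QP] [Q' Q'P]; exists (Q ++ Q') => z z' zz'.
by rewrite (QP z z') ?(Q'P z z') // => h hQ; apply: zz'; rewrite mem_cat hQ ?orbT.
Qed.

Lemma local_op (T W : Type) (op : T -> W) a : local a -> local (fun z => op (a z)).
Proof. by move=> la; apply: (local_op2 (fun t _ => op t) la (local_const tt)). Qed.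

(** A position may depend on the configuration as long as it ranges over a finite list: the union of
    the windows of its values is again a window. This makes following moves local. *)
Lemma local_bind (T : eqType) (W : Type) (l : seq T) (a : (H -> B) -> T)
    (b : T -> (H -> B) -> W) :
  (forall z, a z \in l) -> local a -> (forall t, local (b t)) ->
  local (fun z => b (a z) z).
Proof.
move=> al [Qa QaP] lb.
have [Q QP] : exists Q : seq H, forall t, t \in l -> forall z z' : H -> B,
    {in Q, z =1 z'} -> b t z = b t z'.
  elim: l {al} => [|t l [Q QP]]; first by exists [::].
  have [Q' Q'P] := lb t; exists (Q' ++ Q) => u; rewrite inE => /predU1P[-> | ul] z z' zz'.
    by apply: Q'P => h hQ; apply: zz'; rewrite mem_cat hQ.
  by apply: QP => // h hQ; apply: zz'; rewrite mem_cat hQ orbT.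
exists (Qa ++ Q) => z z' zz'; rewrite (QaP z z') => [|h hQ]; last first.
  by apply: zz'; rewrite mem_cat hQ.
by apply: QP => // h hQ; apply: zz'; rewrite mem_cat hQ orbT.
Qed.

Lemma local_all (T : Type) (l : seq T) (b : T -> (H -> B) -> bool) :
  (forall t, local (b t)) -> local (fun z => all (fun t => b t z) l).
Proof.
move=> lb; elim: l => [|t l IHl] /=; first exact: local_const.
exact: (local_op2 andb (lb t) IHl).
Qed.

Lemma local_has (T : Type) (l : seq T) (b : T -> (H -> B) -> bool) :
  (forall t, local (b t)) -> local (fun z => has (fun t => b t z) l).
Proof.
move=> lb; elim: l => [|t l IHl] /=; first exact: local_const.
exact: (local_op2 orb (lb t) IHl).
Qed.

Lemma local_SFT (rule : (H -> B) -> bool) : local rule ->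
  SFT [set y : H -> B | forall h, rule (fun k => y (h * k))].
Proof.
move=> [Q QP]; pose D : {fset H} := [fset q in Q]%fset.
(* Forbidden are the patterns on the window all of whose extensions violate the rule; by locality
   one violating extension suffices. *)
pose bad (phi : {ffun D -> B}) :=
  `[< forall z : H -> B, (forall q : D, z (val q) = phi q) -> ~~ rule z >].
pose pat (phi : {ffun D -> B}) : {fmap H -> B} := [fmap q : D => phi q]%fmap.
exists [fset p in [seq pat phi | phi <- enum bad]]%fset.
apply/seteqP; split=> y /= yP.
  move=> g _ /[!inE] /mapP[phi + ->]; rewrite mem_enum => /asboolP bad_phi cyl.
  have := yP g^-1; apply/negP/bad_phi => q.
  by have := cyl q; rewrite ffunE.
move=> h; apply: contraT => not_rule; pose z k := y (h * k).
pose phi : {ffun D -> B} := [ffun q => z (val q)].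
exfalso; apply: (yP h^-1 (pat phi)).
  rewrite !inE; apply: map_f; rewrite mem_enum; apply/asboolP => z' z'P.
  rewrite (QP z' z) // => q qQ; have qD : q \in D by rewrite !inE.
  by have := z'P [` qD]%fset; rewrite ffunE.
by move=> q; rewrite /pat !ffunE /shift invgK.
Qed.

End Local.

(** * The simulating subshift *)

Section Cells.
Variables (G H : groupType) (n : nat) (s : 'I_n -> G) (R : seq (free_group n)).
Hypothesis s_gen : forall g, exists w, fg_eval s w = g.
Hypothesis s_rel : [set w | fg_eval s w = 1] = normal_closure [set` R].
Variables (A : finType) (F : {fset {fmap G -> A}}).
Variables (V : {fset G}) (D K : {fset H}).

(* [y h v = Some (a, m)] says that [(h, v)] is live and carries the letter [a],
   and that for [m l = (d, v')] the generator [l] moves it to [(h * d, v')]. *)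
Definition symbol : finType := {ffun V -> option (A * {ffun letter n -> D * V})}.
Implicit Types (y : H -> symbol) (st : H * V) (w : seq (letter n)).

Definition live y st : bool := y st.1 st.2.

(** A dead cell stays put, a default that makes the move total. *)
Definition act y st (l : letter n) : H * V :=
  if y st.1 st.2 is Some (_, m) then (st.1 * val (m l).1, (m l).2) else st.

Definition run y := foldl (act y).

Definition color y st : option A := omap fst (y st.1 st.2).

Definition word_for (g : G) : free_group n := projT1 (cid (s_gen g)).

Lemma fg_eval_word_for g : fg_eval s (word_for g) = g.
Proof. by rewrite /word_for; case: cid. Qed.

Definition cell_rule y st : bool :=
  [&& all (fun l => live y (act y st l) && (act y (act y st l) (inv_letter l) == st))
        (enum {: letter n}),
      all (fun r => run y st (fg_word r) == st) R
    & all (fun p : {fmap G -> A} => ~~ all (fun q : domf p =>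
        color y (run y st (fg_word (word_for (val q)))) == Some (p q)) (enum {: domf p})) F].

(** Only cells over the identity are tested, since [cell_shift] imposes the rule at every translate.
    The second conjunct excludes the configuration without live cells. *)
Definition rule y : bool :=
  all (fun v => live y (1, v) ==> cell_rule y (1, v)) (enum {: V})
  && has (fun k : K => has (fun v => live y (val k, v)) (enum {: V})) (enum {: K}).

Lemma local_live st : local (fun y => live y st).
Proof. exact: (local_op (fun b : symbol => isSome (b st.2)) (local_at _ st.1)). Qed.

Lemma local_act st l : local (fun y => act y st l).
Proof.
exact: (local_op (fun b : symbol => if b st.2 is Some (_, m)
  then (st.1 * val (m l).1, (m l).2) else st) (local_at _ st.1)).
Qed.

Lemma local_act_bind (W : Type) (b : H * V -> (H -> symbol) -> W) st l :
  (forall t, local (b t)) -> local (fun y => b (act y st l) y).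
Proof.
apply: (local_bind (l := st :: [seq (st.1 * val d, v) | d <- enum {: D}, v <- enum {: V}])).
  move=> y; rewrite inE /act; case: (y _ _) => [[a m]|]; last by rewrite eqxx.
  apply/orP; right; apply/allpairsP; exists ((m l).1, (m l).2) => /=.
  by rewrite !mem_enum.
exact: local_act.
Qed.

Lemma local_run_bind (W : Type) (b : H * V -> (H -> symbol) -> W) w st :
  (forall t, local (b t)) -> local (fun y => b (run y st w) y).
Proof.
move=> lb; elim: w st => [|l w IHw] st /=; first exact: lb.
exact: (local_act_bind (b := fun t y => b (run y t w) y)).
Qed.

Lemma local_rule : local rule.
Proof.
apply: (local_op2 andb); last first.
  by apply: local_has => k; apply: local_has => v; apply: local_live.
apply: local_all => v; apply: (local_op2 implb); first exact: local_live.
apply: (local_op2 andb).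
  apply: local_all => l; apply: (local_op2 andb).
    by apply: (local_act_bind (b := fun t y => live y t)) => t; apply: local_live.
  apply: (local_act_bind (b := fun t y => act y t (inv_letter l) == (1, v))) => t.
  by apply: (local_op (fun u => u == _)); apply: local_act.
apply: (local_op2 andb).
  apply: local_all => r; apply: (local_run_bind (b := fun t y => t == (1, v))) => t.
  exact: local_const.
apply: local_all => p; apply: (local_op negb); apply: local_all => q.
apply: (local_run_bind (b := fun t y => color y t == Some (p q))) => t.
exact: (local_op (fun b : symbol => omap fst (b t.2) == Some (p q)) (local_at _ t.1)).
Qed.

Definition cell_shift : set (H -> symbol) :=
  [set y | forall h, rule (fun k => y (h * k))].

Lemma SFT_cell_shift : SFT cell_shift.
Proof. exact: local_SFT local_rule. Qed.

Definition translate (h : H) st : H * V := (h * st.1, st.2).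

Lemma translate_inj h : injective (translate h).
Proof. by move=> [k v] [k' v'] [/mulgI-> ->]. Qed.

(** Moves multiply on the right and so commute with left translation; this carries the rule from the
    identity to all of [H]. *)
Lemma run_translate y h st w :
  run y (translate h st) w = translate h (run (fun k => y (h * k)) st w).
Proof.
elim: w st => //= l w IHw st; rewrite -IHw; congr run.
by rewrite /act /translate /=; case: (y _ _) => [[a m]|] //=; rewrite mulgA.
Qed.

Lemma act_translate y h st l :
  act y (translate h st) l = translate h (act (fun k => y (h * k)) st l).
Proof. exact: (run_translate y h st [:: l]). Qed.

Lemma cell_rule_translate y h st :
  cell_rule y (translate h st) = cell_rule (fun k => y (h * k)) st.
Proof.
rewrite /cell_rule; congr [&& _, _ & _].
- apply: eq_all => l; rewrite !act_translate (inj_eq (@translate_inj h)).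
  by [].
- by apply: eq_all => r; rewrite run_translate (inj_eq (@translate_inj h)).
- by apply: eq_all => p; congr negb; apply: eq_all => q; rewrite run_translate.
Qed.

Lemma cell_shiftP y : cell_shift y <->
  (forall st, live y st -> cell_rule y st) /\
  (forall h, exists (k : K) v, live y (h * val k, v)).
Proof.
split=> [yP | [cellP denseP] h].
  split=> [[h v] | h].
    have /andP[/allP/(_ v) + _] := yP h; rewrite mem_enum -cell_rule_translate /live.
    by rewrite /translate /= mulg1 => /(_ isT)/implyP.
  have /andP[_ /hasP[k _ /hasP[v _ kv]]] := yP h.
  by exists k, v.
apply/andP; split.
  apply/allP => v _; apply/implyP => v_live; rewrite -cell_rule_translate.
  exact: cellP.
have [k [v kv]] := denseP h; apply/hasP; exists k; first by rewrite mem_enum.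
by apply/hasP; exists v; rewrite ?mem_enum.
Qed.

(** * Decoding into configurations on [G] *)

Section Decode.
Variables (y : H -> symbol) (yP : cell_shift y).

Let cellP := proj1 (proj1 (cell_shiftP y) yP).

Lemma act_live st l : live y st -> live y (act y st l).
Proof.
by move=> /cellP/and3P[/allP/(_ l) + _ _]; rewrite mem_enum => /(_ isT)/andP[].
Qed.

Lemma actK st l : live y st -> act y (act y st l) (inv_letter l) = st.
Proof.
by move=> /cellP/and3P[/allP/(_ l) + _ _]; rewrite mem_enum => /(_ isT)/andP[_ /eqP].
Qed.

Lemma run_live st w : live y st -> live y (run y st w).
Proof. by elim: w st => //= l w IHw st /(act_live l)/IHw. Qed.

Lemma run_cons_red st l w : live y st -> run y st (cons_red l w) = run y (act y st l) w.
Proof.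
move=> st_live; case: w => [|b w] //=; case: eqP => [-> | //].
by rewrite actK.
Qed.

Lemma run_mul_red st u w : live y st -> run y st (mul_red u w) = run y (run y st u) w.
Proof.
elim: u st => //= l u IHu st st_live.
by rewrite run_cons_red // IHu // act_live.
Qed.

Lemma runM st (u v : free_group n) : live y st ->
  run y st (fg_word (u * v)) = run y (run y st (fg_word u)) (fg_word v).
Proof. exact: run_mul_red. Qed.

Definition stabilizer : set (free_group n) :=
  [set u | forall st, live y st -> run y st (fg_word u) = st].

(** Fixing is asked at all live cells at once and runs keep cells live, whence closure under
    conjugation. *)
Lemma stabilizer_normal : normal_subgroup stabilizer.
Proof.
have sV u : stabilizer u -> stabilizer u^-1.
  move=> uP st st_live; rewrite -[LHS]uP ?run_live // -runM // mulVg //.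
split=> // [u v uP vP st st_live | u v uP st st_live].
  by rewrite runM // uP // vP.
rewrite conjgE runM // runM ?run_live // uP ?run_live // -runM // mulVg //.
Qed.

(* The stabilizer of all live points is a normal subgroup containing the relators,
   so the action of the free group factors through [G]. *)
Lemma run_eval st (u v : free_group n) : live y st -> fg_eval s u = fg_eval s v ->
  run y st (fg_word u) = run y st (fg_word v).
Proof.
move=> st_live uv.
have /(_ (u * v^-1)) : normal_closure [set` R] `<=` stabilizer.
  move=> w /(_ _ stabilizer_normal); apply=> r /= rR t /cellP/and3P[_ /allP/(_ _ rR)/eqP + _].
  by [].
rewrite -s_rel /=.
have eval1 : fg_eval s (u * v^-1) = 1.
  apply: (mulIg (fg_eval s v)); rewrite -fg_evalM mulgVK mul1g //.
by move=> /(_ eval1)/(_ st st_live) {2}<-; rewrite -runM // mulgVK.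
Qed.

Variables (a0 : A) (st0 : H * V).
Hypothesis st0_live : live y st0.

(** Runs from [st0] stay live, so the default [a0] is never taken. *)
Definition decoded (g : G) : A := odflt a0 (color y (run y st0 (fg_word (word_for g)))).

(** Any word for the element may replace the chosen one; the decoding program finds words of its
    own. *)
Lemma decoded_run w : decoded (\prod_(l <- w) letter_eval s l) =
  odflt a0 (color y (run y st0 w)).
Proof.
rewrite /decoded (@run_eval _ _ (reduce w)) ?fg_eval_word_for ?fg_eval_reduce //.
by rewrite /= run_mul_red.
Qed.

(** A pattern forbidden by [F] and seen in [shift g decoded] would be read along the moves at the
    live cell reached from [st0] by [g^-1], against its cell rule. *)
Lemma decoded_SFT : [set x : G -> A | forall g p, p \in F -> ~ cylinder p (shift g x)] decoded.
Proof.
move=> g p pF cyl; have := run_live (fg_word (word_for g^-1)) st0_live.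
move/cellP/and3P=> [_ _ /allP/(_ _ pF)/negP]; apply; apply/allP => q _.
rewrite -runM // (@run_eval _ _ (word_for (g^-1 * val q))) //; last first.
  by rewrite fg_evalM !fg_eval_word_for.
have /= := cyl q; rewrite /shift /decoded.
have := run_live (fg_word (word_for (g^-1 * val q))) st0_live.
by rewrite /live /color; case: (y _ _) => [[a m] _ /= ->|].
Qed.

End Decode.

(** * Encoding of configurations on [G] *)

Section Encode.
Variables (f : G -> H) (r : H -> G).
Hypothesis D_step : forall g l, (f g)^-1 * f (g * letter_eval s l) \in D.
Hypothesis V_shift : forall g, (r (f g))^-1 * g \in V.
Hypothesis K_dense : forall h, exists g, h^-1 * f g \in K.
Variable x : G -> A.
Hypothesis xP : forall g p, p \in F -> ~ cylinder p (shift g x).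

Definition cell (g : G) : A * {ffun letter n -> D * V} :=
  (x g, [ffun l => ([` D_step g l], [` V_shift (g * letter_eval s l)])])%fset.

(** The only [g] that can sit at [(h, v)] is [r h * v]; it does so exactly when [f] sends it to
    [h]. *)
Definition encoded (h : H) : symbol :=
  [ffun v : V => let g := r h * val v in if f g == h then Some (cell g) else None].

Definition embed (g : G) : H * V := (f g, [` V_shift g])%fset.

Lemma encoded_embed g : encoded (f g) [` V_shift g]%fset = Some (cell g).
Proof. by rewrite ffunE /= mulVKg eqxx. Qed.

Lemma live_embed st : live encoded st <-> exists g, st = embed g.
Proof.
split=> [|[g ->]]; last by rewrite /live encoded_embed.
case: st => h v; rewrite /live ffunE /=; case: eqP => // fg _.
exists (r h * val v); rewrite /embed; congr (_, _) => //.
by apply: val_inj; rewrite /= fg mulKg.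
Qed.

Lemma act_embed g l : act encoded (embed g) l = embed (g * letter_eval s l).
Proof. by rewrite /act encoded_embed /= !ffunE /= mulVKg. Qed.

Lemma run_embed g w : run encoded (embed g) w = embed (g * \prod_(l <- w) letter_eval s l).
Proof.
elim: w g => [|l w IHw] g /=; first by rewrite big_nil mulg1.
by rewrite act_embed IHw big_cons mulgA.
Qed.

(** Under [embed] moves become right multiplication in [G]: inverse letters cancel, relators
    evaluate to 1, and a pattern read at [g] occurs in [shift g^-1 x]. *)
Lemma encoded_cell_shift : cell_shift encoded.
Proof.
apply/cell_shiftP; split=> [_ /live_embed[g ->] | h]; last first.
  have [g gK] := K_dense h; exists [` gK]%fset, [` V_shift g]%fset.
  by apply/live_embed; exists g; rewrite /embed /= mulVKg.
apply/and3P; split; apply/allP; [move=> l _ | move=> u uR | move=> p pF].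
- rewrite !act_embed letter_evalV mulgK eqxx andbT.
  by apply/live_embed; exists (g * letter_eval s l).
- have : normal_closure [set` R] u by move=> N _; apply.
  by rewrite -s_rel run_embed /= /fg_eval => ->; rewrite mulg1.
- apply/negP => /allP colP; apply: (xP (g := g^-1) pF) => q.
  have := colP q; rewrite mem_enum => /(_ isT)/eqP; rewrite run_embed -/(fg_eval _ _).
  have := fg_eval_word_for (val q); rewrite /fg_eval => ->.
  by rewrite /color encoded_embed => -[<-]; rewrite /shift invgK.
Qed.

End Encode.
End Cells.

(** * Computability of the encoding and the decoding *)

Section Transfer.
Variables (G H : groupType) (e : nat -> G) (e' : nat -> H).
Hypotheses (eP : numbering e) (e'P : numbering e').
Variables (n : nat) (s : 'I_n -> G).
Hypothesis s_gen : forall g, exists w, fg_eval s w = g.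
Variables (A : finType) (V : {fset G}) (D K : {fset H}).
Notation symbol := (symbol n A V D).

Lemma computable_encoded (f : G -> H) (r : H -> G)
    (D_step : forall g l, (f g)^-1 * f (g * letter_eval s l) \in D)
    (V_shift : forall g, (r (f g))^-1 * g \in V) (I : Type) (x : I -> G -> A) :
  recursive_map e e' f -> recursive_map e' e r ->
  computable_from e e' x (fun i => encoded D_step V_shift (x i)).
Proof.
move=> [F rF FE] [S rS SE] o cx.
have [m rm mE] := numbering_mul eP; have [m' rm' m'E] := numbering_mul e'P.
have [c cE] := choice (numbering_surj eP); have [c' c'E] := choice (numbering_surj e'P).
have ccell : fcomp o (fun i p => cell D_step V_shift (x i) (e p)).
  apply: fcomp_pair cx _; apply: fcomp_ffun => l.
  pose q p := m (npair p (c (letter_eval s l))).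
  have rq : recursive q by apply: comp_recursive rm (comp_pair (comp_id _) (comp_const _ _)).
  have qE p : e (q p) = e p * letter_eval s l by rewrite /q mE cE.
  have cFq : comp o (fun _ p => F (q p)).
    exact: comp_recursive rF (comp_recursive rq (comp_id _)).
  (* The inverses in [D_step] and [V_shift] are cleared, leaving equalities of products, which the
     numberings decide. *)
  pose RD (d : D) (i : I) p := e' (m' (npair (F p) (c' (val d)))) == e' (F (q p)).
  pose RV (v : V) (i : I) p := e (m (npair (S (F (q p))) (c (val v)))) == e (q p).
  have cRD d : dec o (RD d).
    exact: (dec_numbering_eq e'P (comp_recursive rm'
      (comp_pair (comp_recursive rF (comp_id o)) (comp_const o (c' (val d))))) cFq).
  have cRV v : dec o (RV v).
    exact: (dec_numbering_eq eP (comp_recursive rm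
      (comp_pair (comp_recursive rS cFq) (comp_const o (c (val v)))))
      (comp_recursive rq (comp_id o))).
  have RDE i p d : RD d i p = ([` D_step (e p) l]%fset == d).
    rewrite -val_eqE /RD m'E c'E !FE qE /=.
    by rewrite -[RHS](inj_eq (mulgI (f (e p)))) mulVKg eq_sym.
  have RVE i p v : RV v i p = ([` V_shift (e p * letter_eval s l)]%fset == v).
    rewrite -val_eqE /RV mE cE !SE FE qE /=.
    by rewrite -[RHS](inj_eq (mulgI (r (f (e p * letter_eval s l))))) mulVKg eq_sym.
  apply: fcomp_ext (fcomp_pair (fcomp_pred cRD RDE) (fcomp_pred cRV RVE)) => i p.
  by rewrite ffunE.
apply: fcomp_ffun => v; pose q p := m (npair (S p) (c (val v))).
have rq : recursive q.
  exact: comp_recursive rm (comp_pair (comp_recursive rS (comp_id _)) (comp_const _ _)).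
have cq : comp o (fun _ => q) by apply: comp_recursive rq (comp_id _).
apply: fcomp_ext (fcomp_if (dec_numbering_eq e'P (comp_recursive rF cq) (comp_id _))
  (fcomp_map Some (fcomp_app ccell cq)) (fcomp_const _ None)) => i p.
by rewrite ffunE FE /q mE cE SE.
Qed.

Variables (R : seq (free_group n)) (F : {fset {fmap G -> A}}) (v0 : V) (a0 : A).
Hypothesis s_rel : [set w | fg_eval s w = 1] = normal_closure [set` R].

(** Inspecting the finitely many cells over [K] finds a live one in any point of the subshift;
    [(1, v0)] is a mere default. *)
Definition start (y : H -> symbol) : H * V :=
  if [pick kv : K * V | live y (val kv.1, kv.2)] is Some kv then (val kv.1, kv.2) else (1, v0).

Lemma start_live y : cell_shift R s_gen F K y -> live y (start y).
Proof.
move=> /cell_shiftP[_ /(_ 1)[k [v kv]]]; rewrite /start.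
by case: pickP => // /(_ (k, v)); rewrite -[val (k, v).1]mul1g kv.
Qed.

(** The program searches for a word for the element, follows its moves from the start cell on codes
    of cells, and reads the letter reached. *)
Lemma computable_decoded (I : Type) (y : I -> H -> symbol) :
  (forall i, cell_shift R s_gen F K (y i)) ->
  computable_from e' e y (fun i => decoded s_gen (y i) a0 (start (y i))).
Proof.
move=> yP o cy.
have [m rm mE] := numbering_mul e'P.
have [c cE] := choice (numbering_surj e'P).
pose vdec p : V := nth v0 (enum {: V}) p.
have vdecK (v : V) : vdec (enum_rank v) = v by apply: nth_enum_rank.
pose rep p (st : H * V) := e' (nfst p) = st.1 /\ vdec (nsnd p) = st.2.
have [start_code cstart startP] : exists2 p, comp o p & forall i m, rep (p i m) (start (y i)).
  pose live_at i (_ : nat) : {ffun K * V -> bool} := [ffun kv => live (y i) (val kv.1, kv.2)].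
  have clive : fcomp o live_at.
    apply: fcomp_ffun => kv.
    apply: fcomp_ext (fcomp_map (fun b : symbol => isSome (b kv.2))
      (fcomp_app cy (comp_const o (c (val kv.1))))) => i p.
    by rewrite ffunE cE.
  pose code (phi : {ffun K * V -> bool}) := if [pick kv | phi kv] is Some kv
    then npair (c (val kv.1)) (enum_rank kv.2) else npair (c 1) (enum_rank v0).
  exists (fun i p => code (live_at i p)); first exact: comp_fcomp.
  move=> i ?; rewrite /code /start (eq_pick (Q := fun kv => live (y i) (val kv.1, kv.2))).
    by case: pickP => [kv _|_]; split; rewrite nE ?cE ?vdecK.
  by move=> kv; rewrite ffunE.
(* A move depends only on the symbol, the second coordinate and the letter: finite data, so a table
   gives it. *)
pose T : finType := (symbol * V * option (letter n))%type.
pose move_by (t : T) := if t.2 is Some l then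
  if t.1.1 t.1.2 is Some (_, mv) then Some (mv l) else None else None.
pose tH (t : T) := c (if move_by t is Some dv then val dv.1 else 1).
pose tV (t : T) : nat := enum_rank (if move_by t is Some dv then dv.2 else t.1.2).
pose k := @letter_code n; have k_inj : injective k := @letter_code_inj n.
pose t i p a : T := (y i (e' (nfst p)), vdec (nsnd p), letter_of k a).
pose step i p a := npair (m (npair (nfst p) (tH (t i p a)))) (tV (t i p a)).
have csymb f : comp o f -> fcomp o (fun i p => (y i (e' (nfst (f i p))), vdec (nsnd (f i p)))).
  by move=> cf; apply: fcomp_pair (fcomp_app cy (comp_nfst cf)) (fcomp_nth _ _ (comp_nsnd cf)).
have cstep : comp o (fun i p => step i (nfst (nsnd p)) (nsnd (nsnd p))).
  have cp : comp o (fun _ p => nfst (nsnd p)) := comp_nfst (comp_snd _).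
  have ct : fcomp o (fun i p => t i (nfst (nsnd p)) (nsnd (nsnd p))).
    apply: fcomp_pair (csymb _ cp) _.
    exact: (fcomp_letter_of k_inj (comp_nsnd (comp_snd o))).
  apply: comp_pair (comp_fcomp tV ct).
  exact: comp_recursive rm (comp_pair (comp_nfst cp) (comp_fcomp tH ct)).
have stepP i p st l : rep p st -> rep (step i p (k l)) (act (y i) st l).
  move=> [p1 p2]; rewrite /rep /step !nE mE p1 cE vdecK /tV /move_by /= p1 p2.
  rewrite letter_ofK // /act; case: (y i _ _) => [[a mv]|] //=; last by rewrite mulg1.
have [S rS SP] := word_search k_inj eP (tau := letter_eval s)
  (fun g => let: ex_intro w wE := s_gen g in ex_intro _ (fg_word w) wE).
have cS : comp o (fun _ => S) by apply: comp_recursive rS (comp_id _).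
have cfold := comp_foldl (step := fun i _ => step i) cstep cstart cS.
apply: fcomp_ext (fcomp_map (fun bv : symbol * V => odflt a0 (omap fst (bv.1 bv.2)))
  (csymb _ cfold)) => i p /=.
have [w -> <-] := SP p.
rewrite (decoded_run s_rel (yP i)); last exact: start_live.
rewrite seq_codeK /color; congr (odflt _ (omap _ _)).
suff: rep (foldl (step i) (start_code i p) (map k w)) (run (y i) (start (y i)) w).
  by case=> -> ->.
elim: w (start_code i p) (start (y i)) (startP i p) => //= l w IHw q st rep_q.
exact: IHw (stepP _ _ _ _ rep_q).
Qed.

End Transfer.

(** * Transfer of Medvedev degrees *)

Lemma coarse_equivalence_SFT (G H : groupType) (e : nat -> G) (e' : nat -> H)
    (f : G -> H) (A : finType) (X : set (G -> A)) :
  numbering e -> numbering e' -> recursive_map e e' f -> coarse_equivalence f ->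
  finitely_presented G -> SFT X -> X !=set0 ->
  exists (B : finType) (Y : set (H -> B)) (enc : {x | X x} -> H -> B)
      (dcd : {y | Y y} -> G -> A),
    [/\ SFT Y, forall i, Y (enc i), forall i, X (dcd i),
        computable_from e e' (fun i => sval i) enc
      & computable_from e' e (fun i => sval i) dcd].
Proof.
move=> eP e'P rf cf [n [s [R [s_gen s_rel]]]] [F ->] [x0 _].
have [r [rr cr [K0 K0P]]] := quasi_inverse eP e'P rf cf.
(* [D] bounds the effect of one generator. [V] is finite by properness, as [f (r (f g))] is
   [K0]-close to [f g]. [K] comes from density of the image. *)
have [D0 D0P] := coarse_bornologous cf [seq letter_eval s l | l <- enum {: letter n}].
have [V0 V0P] := coarse_proper cf K0.
pose D := [fset d in D0]%fset; pose V := [fset v in V0]%fset.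
have [K1 K1P] := coarse_dense cf; pose K := [fset k^-1 | k in K1]%fset.
have D_step g l : (f g)^-1 * f (g * letter_eval s l) \in D.
  by rewrite inE; apply: D0P; rewrite mulKg map_f // mem_enum.
have V_shift g : (r (f g))^-1 * g \in V.
  by rewrite inE; apply: V0P; apply: K0P.
have K_dense h : exists g, h^-1 * f g \in K.
  have [g gK] := K1P h; exists g; apply/imfsetP; exists ((f g)^-1 * h) => //.
  by rewrite invgM invgK.
pose Y := cell_shift (V := V) (D := D) R s_gen F K.
exists (symbol n A V D), Y, (fun i => encoded D_step V_shift (sval i)),
  (fun i => decoded s_gen (sval i) (x0 1) (start K [` V_shift 1]%fset (sval i))).
split.
- exact: SFT_cell_shift.
- by case=> x xP; apply: encoded_cell_shift.
- case=> y yP; apply: (decoded_SFT s_rel yP); exact: (start_live _ yP).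
- exact: computable_encoded.
- have YP (i : {y | Y y}) : Y (sval i) by case: i.
  exact: (computable_decoded eP e'P [` V_shift 1]%fset (x0 1) s_rel YP).
Qed.

(** A free group of rank 0 is not in bijection with [nat], so an empty family is replaced by the
    single generator 1. *)
Lemma symmetric_generating_exists (G : groupType) m (t : 'I_m -> G) :
  symmetric_generating t -> exists n (s : 'I_n.+1 -> G), generating s.
Proof.
case: m t => [|m] t [t_inj _ gen].
  exists 0, (fun=> 1); split=> [i j _|g]; first by rewrite !ord1.
  exists (reduce [::]); have [[|[]] //] := gen g.
  by rewrite fg_eval_reduce /word_eval !big_nil.
exists m, t; split=> // g; have [w <-] := gen g.
exists (reduce [seq (i, false) | i <- w]); rewrite fg_eval_reduce big_map.
exact: eq_bigr.
Qed.

(** One-hot coding, with a spare bit so that the length is positive even for empty [B]. *)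
Lemma indicator_tuple_inj (B : finType) :
  exists k (c : B -> k.+1.-tuple bool), injective c.
Proof.
exists #|B|, (fun b => [tuple val i == enum_rank b :> nat | i < #|B|.+1]) => b b' E.
have := congr1 (fun u => tnth u (widen_ord (leqnSn _) (enum_rank b))) E.
by rewrite !tnth_mktuple /= eqxx => /esym/eqP/val_inj/enum_rank_inj.
Qed.

Lemma medvedev_SFT_sub (G H : groupType) (e : nat -> G) (e' : nat -> H) (f : G -> H) m
    (t : 'I_m -> H) :
  numbering e -> numbering e' -> recursive_map e e' f -> coarse_equivalence f ->
  finitely_presented G -> symmetric_generating t ->
  medvedev_SFT G `<=` medvedev_SFT H.
Proof.
move=> eP e'P rf cf fpG gen_t _ [n [s [nu [A [k [c [X [[gen_s nuP c_inj] [X_SFT X0 ->]]]]]]]]].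
have [B [Y [enc [dcd [Y_SFT encY dcdX cenc cdcd]]]]] :=
  coarse_equivalence_SFT eP e'P rf cf fpG X_SFT X0.
have [n' [s' gen_s']] := symmetric_generating_exists gen_t.
have [nu' nu'P] := computable_bijection_exists n'.
have [k' [c' c'_inj]] := indicator_tuple_inj B.
exists n'.+1, s', nu', B, k', c', Y; split=> //; split=> //.
  by case: X0 => x Xx; exists (enc (exist _ x Xx)).
(* Decoding gives one reduction and encoding the other. *)
apply: medvedev_degree_eq.
  exact: (coding_le s c e'P eP gen_s' nu'P c'_inj nuP dcdX cdcd).
exact: (coding_le s' c' eP e'P gen_s nuP c_inj nu'P encY cenc).
Qed.

Theorem corollary4p24 (G H : groupType) :
  finitely_presented G ->
  finitely_presented H ->
  computably_quasi_isometric G H ->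
  decidable_word_problem G ->
  decidable_word_problem H ->
  medvedev_SFT G = medvedev_SFT H.
Proof.
move=> fpG fpH [m [t [n [s [f [gen_t gen_s comp_f qi_f]]]]]].
move=> /decidable_word_problem_numbering[e eP] /decidable_word_problem_numbering[e' e'P].
have rf := computable_map_recursive eP e'P gen_t comp_f.
have cf := quasi_isometry_coarse gen_t gen_s qi_f.
have [r [rr cr _]] := quasi_inverse eP e'P rf cf.
apply/seteqP; split; first exact: (medvedev_SFT_sub eP e'P rf cf fpG gen_s).
exact: (medvedev_SFT_sub e'P eP rr cr fpH gen_t).
Qed.
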